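(* Let $\bm\mu^*\in\mathcal{P}(\mathbb{R}^d|\mathbb{T})$ be narrowly continuous and $\psi^*\in C^{1,2}_b(\mathbb{T}\times\mathbb{R}^d)$. Assume there exists a unique measurable $\phi:\mathbb{T}\times\mathbb{R}^d\to A$ such that $\phi(t,x)$ is the unique minimizer over $a\in A$ of $H\big(t,x,\nabla_x\psi^*(t,x),\mathrm{Hess}_x\psi^*(t,x),a,\mu^*_t\big)$ for all $(t,x)\in\mathbb{T}\times\mathbb{R}^d$; that $x\mapsto g(x,\mu^*_T)$ and $(t,x)\mapsto\min_{a\in A}H(t,x,\nabla_x\psi^*(t,x),\mathrm{Hess}_x\psi^*(t,x),a,\mu^*_t)$ are continuous; and that $\mathrm{supp}(\mu^*_t)=\mathbb{R}^d$ for all $t\in(0,T]$, where $\mathrm{supp}(\mu)=\{x:\mu(\{y:|y-x|<r\})>0\ \forall r>0\}$. Then for any $\xi^*\in\mathcal{M}_+(\mathbb{T}\times\mathbb{R}^d\times A)$, the triple $(\bm\mu^*,\xi^*,\psi^* )$ satisfies the primal-dual system (PD) below if and only if $\xi^*(\mathrm{d}t,\mathrm{d}x,\mathrm{d}a)=\delta_{\phi(t,x)}(\mathrm{d}a)\mu^*_t(\mathrm{d}x)\mathrm{d}t$ and (a) for all $\psi\in\mathcal{W}$: $\int\psi(T,x)\mu^*_T(\mathrm{d}x)-\int\psi(0,x)\rho(\mathrm{d}x)=\int_{\mathbb{T}\times\mathbb{R}^d}\big((\mathbb{L}^{\bm\mu^*}\psi)(t,x,\phi(t,x))+\partial_t\psi(t,x)\big)\mu^*_t(\mathrm{d}x)\mathrm{d}t$;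 (b) $\partial_t\psi^*(t,x)+\min_{a\in A}H(t,x,\nabla_x\psi^*(t,x),\mathrm{Hess}_x\psi^*(t,x),a,\mu^*_t)=0$ for all $(t,x)\in\mathbb{T}\times\mathbb{R}^d$, and $\psi^*(T,x)=g(x,\mu^*_T)$ for all $x\in\mathbb{R}^d$.
   Context: Let $T>0$, $\mathbb{T}=[0,T]$, $d\ge1$. $A$ is a Polish space; $b:\mathbb{T}\times\mathbb{R}^d\times A\times\mathcal{P}(\mathbb{R}^d)\to\mathbb{R}^d$, $\sigma:\ldots\to\mathbb{R}^{d\times d}$, $f:\ldots\to\mathbb{R}$ (same domain), $g:\mathbb{R}^d\times\mathcal{P}(\mathbb{R}^d)\to\mathbb{R}$ are bounded and Borel measurable ($\mathcal{P}(\mathbb{R}^d)$ with the weak topology). Fix $\rho\in\mathcal{P}(\mathbb{R}^d)$. $\mathcal{P}(\mathbb{R}^d|\mathbb{T})$: probability kernels $t\mapsto\mu_t$; narrowly continuous means $t\mapsto\int\varphi\,\mathrm{d}\mu_t$ is continuous for every bounded continuous $\varphi$. $\mathcal{M}_+(X)$: finite nonnegative Borel measures. $\mathcal{W}=C^{1,2}_b(\mathbb{T}\times\mathbb{R}^d)$: bounded continuous functions with $\partial_t,\nabla_x,\mathrm{Hess}_x$ existing, bounded, continuous. $(\mathbb{L}^{\bm\mu}\psi)(t,x,a)=\frac12\mathrm{tr}((\sigma\sigma^\top)(t,x,a,\mu_t)\mathrm{Hess}_x\psi(t,x))+b(t,x,a,\mu_t)^\top\nabla_x\psi(t,x)$.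 Hamiltonian: $H(t,x,y,z,a,\mu)=\frac12\mathrm{tr}((\sigma\sigma^\top)(t,x,a,\mu)z)+b(t,x,a,\mu)^\top y+f(t,x,a,\mu)$ for $y\in\mathbb{R}^d$, $z\in\mathbb{R}^{d\times d}$. Primal-dual system (PD) for $(\bm\mu^*,\xi^*,\psi^* )$: (i) $\int g(x,\mu^*_T)\mu^*_T(\mathrm{d}x)+\int f(t,x,a,\mu^*_t)\xi^*(\mathrm{d}t,\mathrm{d}x,\mathrm{d}a)=\int\psi^*(0,x)\rho(\mathrm{d}x)$; (ii) for all $\psi\in\mathcal{W}$, $\int\psi(T,x)\mu^*_T(\mathrm{d}x)-\int\psi(0,x)\rho(\mathrm{d}x)=\int\big((\mathbb{L}^{\bm\mu^*}\psi)(t,x,a)+\partial_t\psi(t,x)\big)\xi^*(\mathrm{d}t,\mathrm{d}x,\mathrm{d}a)$; (iii) $g(x,\mu^*_T)\ge\psi^*(T,x)$ for all $x$; (iv) $\partial_t\psi^*(t,x)+(\mathbb{L}^{\bm\mu^*}\psi^* )(t,x,a)+f(t,x,a,\mu^*_t)\ge0$ for all $(t,x,a)$; (v) for all $\psi\in\mathcal{W}$, $\int_{\mathbb{T}\times\mathbb{R}^d}\psi(t,x)\mu^*_t(\mathrm{d}x)\mathrm{d}t=\int\psi(t,x)\xi^*(\mathrm{d}t,\mathrm{d}x,\mathrm{d}a)$. *)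

(* Defs.v *)
From HB Require Import structures.
From mathcomp Require Import all_boot all_order all_algebra.
From mathcomp Require Import all_classical all_reals all_analysis.
From mathcomp Require Import measurable_realfun.
Set Implicit Arguments.
Unset Strict Implicit.
Unset Printing Implicit Defensive.
Import Order.TTheory GRing.Theory Num.Theory.
Import numFieldNormedType.Exports.
Local Open Scope classical_set_scope.
Local Open Scope ring_scope.

Definition Borel (X : ptopologicalType) := g_sigma_algebraType (@open X).

Definition Rd (R : realType) (d : nat) := Borel 'rV[R]_d.

Definition eucl (R : realType) (d : nat) (x : 'rV[R]_d) : R :=
  Num.sqrt (\sum_(i < d) (x ord0 i) ^+ 2).

Definition bcont (R : realType) (d : nat) (h : 'rV[R]_d -> R) : Prop :=
  continuous h /\ exists M : R, forall x, `|h x| <= M.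

Definition PRd (R : realType) (d : nat) := probability (Rd R d) R.

(* open sets of the weak (narrow) topology on P(R^d): the topology       *)
(* generated by the maps mu |-> \int phi dmu, phi bounded continuous.     *)
Definition weak_open (R : realType) (d : nat) (U : set (PRd R d)) : Prop :=
  forall m, U m ->
    exists (k : nat) (s : nat -> 'rV[R]_d -> R) (e : R),
      0 < e /\ (forall i, (i < k)%N -> bcont (s i)) /\
      (forall n : PRd R d,
          (forall i, (i < k)%N ->
             `|Rintegral n setT (s i) - Rintegral m setT (s i)| < e) -> U n).

Definition PW (R : realType) (d : nat) := g_sigma_algebraType (@weak_open R d).

Definition polish (R : realType) (X : ptopologicalType) : Prop :=
  (exists s : nat -> X, forall U : set X, open U -> U !=set0 -> exists n, U (s n)) /\
  (exists dist : X -> X -> R,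
     (forall x y, 0 <= dist x y) /\ (forall x y, dist x y = 0 <-> x = y) /\
     (forall x y, dist x y = dist y x) /\
     (forall x y z, dist x z <= dist x y + dist y z) /\
     (forall U : set X, open U <->
        (forall x, U x -> exists r : R, 0 < r /\ [set y | dist x y < r] `<=` U)) /\
     (forall u : nat -> X,
        (forall e : R, 0 < e -> exists N, forall m n, (N <= m)%N -> (N <= n)%N ->
            dist (u m) (u n) < e) ->
        exists l : X, u @ \oo --> l)).

Definition evec (R : realType) (d : nat) (i : 'I_d) : 'rV[R]_d := delta_mx ord0 i.

(* psi \in C^{1,2}_b([0,T] x R^d), with Dt = d/dt psi (one-sided at the      *)
(* endpoints of [0,T]), Dx = gradient in x (a row vector) and Hx = Hessian. *)
Definition C12b (R : realType) (d : nat) (T : R) (psi : R -> 'rV[R]_d -> R)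
    (Dt : R -> 'rV[R]_d -> R) (Dx : R -> 'rV[R]_d -> 'rV[R]_d)
    (Hx : R -> 'rV[R]_d -> 'M[R]_d) : Prop :=
  let D := `[0, T]%classic `*` [set: 'rV[R]_d] in
  (forall t x, t \in `[0, T] ->
     (fun s => (psi s x - psi t x) / (s - t)) @ within (`[0, T]%classic `\ t) (nbhs t)
       --> Dt t x) /\
  (forall t x i, t \in `[0, T] -> is_derive x (evec R i) (psi t) (Dx t x ord0 i)) /\
  (forall t x i j, t \in `[0, T] ->
     is_derive x (evec R j) (fun y => Dx t y ord0 i) (Hx t x i j)) /\
  (exists M : R, forall t x, t \in `[0, T] ->
     `|psi t x| <= M /\ `|Dt t x| <= M /\ `|Dx t x| <= M /\ `|Hx t x| <= M) /\
  {within D, continuous (fun z : R * 'rV[R]_d => psi z.1 z.2)} /\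
  {within D, continuous (fun z : R * 'rV[R]_d => Dt z.1 z.2)} /\
  {within D, continuous (fun z : R * 'rV[R]_d => Dx z.1 z.2)} /\
  {within D, continuous (fun z : R * 'rV[R]_d => Hx z.1 z.2)}.

Definition Lgen (R : realType) (d : nat) (A : Type)
    (b : R -> 'rV[R]_d -> A -> PRd R d -> 'rV[R]_d)
    (sig : R -> 'rV[R]_d -> A -> PRd R d -> 'M[R]_d)
    (mu : R -> PRd R d)
    (Dx : R -> 'rV[R]_d -> 'rV[R]_d) (Hx : R -> 'rV[R]_d -> 'M[R]_d)
    (t : R) (x : 'rV[R]_d) (a : A) : R :=
  2^-1 * \tr (sig t x a (mu t) *m (sig t x a (mu t))^T *m Hx t x)
  + \sum_(i < d) b t x a (mu t) ord0 i * Dx t x ord0 i.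

Definition Ham (R : realType) (d : nat) (A : Type)
    (b : R -> 'rV[R]_d -> A -> PRd R d -> 'rV[R]_d)
    (sig : R -> 'rV[R]_d -> A -> PRd R d -> 'M[R]_d)
    (f : R -> 'rV[R]_d -> A -> PRd R d -> R)
    (t : R) (x : 'rV[R]_d) (y : 'rV[R]_d) (z : 'M[R]_d) (a : A) (m : PRd R d) : R :=
  2^-1 * \tr (sig t x a m *m (sig t x a m)^T *m z)
  + \sum_(i < d) b t x a m ord0 i * y ord0 i + f t x a m.

(* min over a in A of the Hamiltonian (as an infimum; it is attained under *)
(* the hypotheses of the theorem)                                          *)
Definition minHam (R : realType) (d : nat) (A : Type)
    (b : R -> 'rV[R]_d -> A -> PRd R d -> 'rV[R]_d)
    (sig : R -> 'rV[R]_d -> A -> PRd R d -> 'M[R]_d)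
    (f : R -> 'rV[R]_d -> A -> PRd R d -> R)
    (t : R) (x : 'rV[R]_d) (y : 'rV[R]_d) (z : 'M[R]_d) (m : PRd R d) : R :=
  inf [set Ham b sig f t x y z a m | a in [set: A]].

Definition PD (R : realType) (d : nat) (A : ptopologicalType) (T : R)
    (b : R -> 'rV[R]_d -> A -> PRd R d -> 'rV[R]_d)
    (sig : R -> 'rV[R]_d -> A -> PRd R d -> 'M[R]_d)
    (f : R -> 'rV[R]_d -> A -> PRd R d -> R)
    (g : 'rV[R]_d -> PRd R d -> R) (rho : PRd R d)
    (mu : R -> PRd R d)
    (xi : {finite_measure set ((R * Rd R d) * Borel A)%type -> \bar R})
    (psis : R -> 'rV[R]_d -> R) (Dts : R -> 'rV[R]_d -> R)
    (Dxs : R -> 'rV[R]_d -> 'rV[R]_d) (Hxs : R -> 'rV[R]_d -> 'M[R]_d) : Prop :=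
  Rintegral (mu T) setT (fun x => g x (mu T))
    + Rintegral xi setT (fun z => f z.1.1 z.1.2 z.2 (mu z.1.1))
    = Rintegral rho setT (fun x => psis 0 x) /\
  (forall psi Dt Dx Hx, C12b T psi Dt Dx Hx ->
     Rintegral (mu T) setT (fun x => psi T x) - Rintegral rho setT (fun x => psi 0 x)
     = Rintegral xi setT
         (fun z => Lgen b sig mu Dx Hx z.1.1 z.1.2 z.2 + Dt z.1.1 z.1.2)) /\
  (forall x, psis T x <= g x (mu T)) /\
  (forall t x a, t \in `[0, T] ->
     0 <= Dts t x + Lgen b sig mu Dxs Hxs t x a + f t x a (mu t)) /\
  (forall psi Dt Dx Hx, C12b T psi Dt Dx Hx ->
     Rintegral lebesgue_measure `[0, T] (fun t => Rintegral (mu t) setT (psi t))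
     = Rintegral xi setT (fun z => psi z.1.1 z.1.2)).

(* Main.v *)
(** Testing the constraints of (PD) against [psis] and subtracting shows that
    the slacks of the two dual inequalities have total integral zero, so
    [g - psis T] vanishes [mu T]-a.e. and
    [G = Dts + Lgen psis + f] vanishes [xi]-a.e.  By (v) the time-space marginal
    of [xi] is [mu t (dx) dt], since the logistic functions of
    [logistic_C12b] lie in the test class and approximate the indicators of closed
    orthants.  The continuous function [Dts + minHam] lies between [0] and [G], so
    it vanishes a.e., hence everywhere by full support; and [G = 0] then forces
    the action to be the unique minimizer [phi], which identifies [xi] as the
    image of its marginal under the graph of [phi].  The converse direction is a
    change of variables along that graph. *)

Require Import Defs.
From HB Require Import structures.
From mathcomp Require Import all_boot all_order all_algebra.
From mathcomp Require Import all_classical all_reals all_analysis.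
From mathcomp Require Import measurable_realfun ring lra.
Set Implicit Arguments.
Unset Strict Implicit.
Unset Printing Implicit Defensive.
Import Order.TTheory GRing.Theory Num.Theory.
Import numFieldNormedType.Exports.
Local Open Scope classical_set_scope.
Local Open Scope ring_scope.

(** The coefficients, the test functions and [mu] are controlled only for times in [[0, T]], whereas
    [xi] is a measure over all real times that is null off the strip. An integrand over the whole
    space may therefore fail to be measurable, so each integral is first cut down to the strip, and
    the kernel and the feedback are extended by projecting time onto [[0, T]].

    Condition (v) only compares integrals of smooth bounded functions and must be upgraded to an
    equality of measures. Logistic functions serve this purpose because their derivatives are
    polynomials in ratios that stay in [[0, 1]], so membership in the test class is a direct
    computation.

    Full support is given for positive times only. The initial time is reached by continuity: every
    neighbourhood of a point at time 0 contains a whole interval of positive times. *)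

(** * Integration over a conull set, and bounded measurable functions *)

Section conull.
Local Open Scope ereal_scope.
Context d (T : measurableType d) (R : realType) (m : {measure set T -> \bar R}).
Variables (D : set T).
Hypotheses (mD : measurable D) (mDC : m (~` D) = 0).
Import HBNNSimple.

(** The integral of a nonnegative function is a supremum over the simple functions below it, so the
    argument covers arbitrary [f]: multiplying a simple function by the indicator of [D] keeps its
    integral, because the complement of [D] is null. *)
Lemma ge0_integral_conull (f : T -> \bar R) : (forall x, 0 <= f x) ->
  \int[m]_x f x = \int[m]_(x in D) f x.
Proof.
move=> f0; rewrite [RHS]integral_mkcond.
have fD0 x : 0 <= (f \_ D) x by apply: erestrict_ge0 => // y _.
rewrite !ge0_integralTE//; apply/eqP; rewrite eq_le; apply/andP; split.
  apply: ge_ereal_sup => _ [h /= hf <-].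
  apply: ereal_sup_ubound; exists (proj_nnsfun h mD) => [x|].
    rewrite /= /proj_nnsfun /= patchE mindicE.
    by case: ifPn => /= xD; rewrite ?xD ?(negbTE xD) ?mulr1 ?mulr0.
  rewrite -!integralT_nnsfun.
  rewrite (ge0_negligible_integral (N := ~` D))//; first last.
  - by move=> x _; rewrite lee_fin.
  - exact/measurable_EFinP.
  - exact: measurableC.
  rewrite [RHS](ge0_negligible_integral (N := ~` D))//; first last.
  - by move=> x _; rewrite lee_fin.
  - exact/measurable_EFinP.
  - exact: measurableC.
  apply: eq_integral => x; rewrite inE setTD setCK /= => Dx.
  by rewrite mindicE mem_set// mulr1.
apply: ge_ereal_sup => _ [h /= hf <-].
apply: ereal_sup_ubound; exists h => // x; apply: (le_trans (hf x)).
by rewrite patchE; case: ifPn.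
Qed.

Lemma integral_conull (f : T -> \bar R) :
  \int[m]_x f x = \int[m]_(x in D) f x.
Proof.
by rewrite [LHS]integralE [RHS]integralE; congr (_ - _); apply: ge0_integral_conull.
Qed.

Lemma Rintegral_conull (f : T -> R) :
  (\int[m]_x f x = \int[m]_(x in D) f x)%R.
Proof. by rewrite /Rintegral integral_conull. Qed.

End conull.

Section bounded_measurable.
Context d (T : measurableType d) (R : realType).
Variables (D : set T).
Hypotheses (mD : measurable D).
Implicit Types f g : T -> R.

(** A class closed under sums and products and integrable for every measure finite on [D]; carrying
    it along replaces separate integrability arguments. *)
Definition bmeas f :=
  measurable_fun D f /\ exists M : R, forall x, D x -> `|f x| <= M.

Lemma bmeas_cst r : bmeas (cst r).
Proof. by split; [exact: measurable_cst | exists `|r|]. Qed.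

Lemma bmeas_eq f g : (forall x, D x -> f x = g x) -> bmeas f -> bmeas g.
Proof.
move=> fg [mf [M hM]]; split; last by exists M => x Dx; rewrite -fg//; exact: hM.
by apply: eq_measurable_fun mf => x; rewrite inE => /fg.
Qed.

Lemma bmeasD f g : bmeas f -> bmeas g -> bmeas (f \+ g).
Proof.
move=> [mf [M hM]] [mg [N hN]]; split; first exact: measurable_funD.
exists (M + N) => x Dx; apply: (le_trans (ler_normD _ _)).
by apply: lerD; [exact: hM | exact: hN].
Qed.

Lemma bmeasN f : bmeas f -> bmeas (\- f).
Proof.
move=> [mf [M hM]]; split; first exact: measurableT_comp.
by exists M => x Dx; rewrite normrN; exact: hM.
Qed.

Lemma bmeasB f g : bmeas f -> bmeas g -> bmeas (f \- g).
Proof. by move=> bf bg; apply: bmeasD => //; exact: bmeasN. Qed.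

Lemma bmeasM f g : bmeas f -> bmeas g -> bmeas (f \* g).
Proof.
move=> [mf [M hM]] [mg [N hN]]; split; first exact: measurable_funM.
exists (M * N) => x Dx; rewrite normrM.
by apply: ler_pM => //; [exact: hM | exact: hN].
Qed.

Lemma bmeas_sum n (f : 'I_n -> T -> R) :
  (forall i, bmeas (f i)) -> bmeas (fun x => \sum_(i < n) f i x).
Proof.
move=> bf; rewrite (_ : (fun x => _) = \big[(fun u v => u \+ v)/cst 0]_(i < n) f i).
  by apply: big_ind => [|u v|i _]; [exact: bmeas_cst|exact: bmeasD|exact: bf].
apply/funext => x; elim/big_ind2 : _ => [//|u u' v v' -> ->//|//].
Qed.

Lemma bmeas_integrable (m : {measure set T -> \bar R}) f :
  (m D < +oo)%E -> bmeas f -> m.-integrable D (EFin \o f).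
Proof.
move=> mfin [mf [M hM]]; apply: measurable_bounded_integrable => //.
exists M; split; first exact: num_real.
by move=> r Mr x Dx; apply: le_trans (hM _ Dx) (ltW Mr).
Qed.

Lemma bmeas_RintegralD (m : {measure set T -> \bar R}) f g :
  (m D < +oo)%E -> bmeas f -> bmeas g ->
  \int[m]_(x in D) (f x + g x) = \int[m]_(x in D) f x + \int[m]_(x in D) g x.
Proof. by move=> mfin bf bg; apply: RintegralD => //; exact: bmeas_integrable. Qed.

Lemma bmeas_RintegralB (m : {measure set T -> \bar R}) f g :
  (m D < +oo)%E -> bmeas f -> bmeas g ->
  \int[m]_(x in D) (f x - g x) = \int[m]_(x in D) f x - \int[m]_(x in D) g x.
Proof. by move=> mfin bf bg; apply: RintegralB => //; exact: bmeas_integrable. Qed.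

Lemma Rintegral_eq0_null (m : {measure set T -> \bar R}) f :
  (m D < +oo)%E -> bmeas f -> (forall x, D x -> 0 <= f x) ->
  \int[m]_(x in D) f x = 0 -> m (D `&` [set x | f x != 0]) = 0%E.
Proof.
move=> mfin bf f0 If.
have If' : (\int[m]_(x in D) `|(f x)%:E| = 0)%E.
  have -> : (\int[m]_(x in D) `|(f x)%:E| = \int[m]_(x in D) (f x)%:E)%E.
    by apply: eq_integral => x; rewrite inE => Dx; rewrite gee0_abs// lee_fin f0.
  have /fineK <- : (\int[m]_(x in D) (f x)%:E)%E \is a fin_num.
    by apply: integrable_fin_num => //; exact: bmeas_integrable.
  by congr EFin.
have mf : measurable_fun D (EFin \o f) by apply/measurable_EFinP; case: bf.
move/(ae_eq_integral_abs m mD mf) : If' => -[N [mN mN0 sN]].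
have mS : measurable (D `&` [set x | f x != 0]).
  have := bf.1 mD (~` [set 0]) (measurableC (measurable_set1 0)).
  by congr measurable; apply/seteqP; split => x /= [Dx /eqP].
apply/eqP; rewrite eq_le measure_ge0 andbT -mN0; apply: le_measure; rewrite ?inE//.
by move=> x [Dx /= fx]; apply: sN => /= /(_ Dx) [] /eqP; apply/negP.
Qed.

End bounded_measurable.

Lemma probability_fin d (T : measurableType d) (R : realType)
  (P : probability T R) : (P setT < +oo)%E.
Proof. by rewrite probability_setT ltry. Qed.

Lemma bmeas_Rintegral_le d (T : measurableType d) (R : realType)
    (P : probability T R) (f : T -> R) M :
  bmeas setT f -> (forall x, `|f x| <= M) -> `|\int[P]_x f x| <= M.
Proof.
move=> bf hM; have If := bmeas_integrable measurableT (probability_fin P) bf.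
apply: (le_trans (le_normr_Rintegral measurableT If)).
have -> : M = \int[P]_(x in [set: T]) M.
  by rewrite Rintegral_cst// [X in fine X](probability_setT P) mulr1.
apply: le_Rintegral => //.
- exact: integrable_norm.
- by apply: bmeas_integrable (bmeas_cst _ M) => //; exact: probability_fin.
Qed.

Lemma Rintegral_eq0 d (X : measurableType d) (R : realType)
    (m : {measure set X -> \bar R}) (D : set X) (F : X -> R) :
  (forall x, D x -> F x = 0) -> \int[m]_(x in D) F x = 0.
Proof. by move=> F0; rewrite /Rintegral integral0_eq// => x /F0 ->. Qed.

(** * Borel measurability on time-space from coordinates *)

Section borel_coordinates.
Context (R : realType) (d : nat).

Lemma measurable_coord (i : 'I_d) :
  measurable_fun setT (fun x : Rd R d => (x : 'rV[R]_d) ord0 i).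
Proof.
apply: (measurability _ (RGenOpens.measurableE R)) => _ [_ [a [b ->]] <-].
rewrite setTI; apply: sub_sigma_algebra.
apply: open_comp; last exact: interval_open.
by move=> x _; exact: coord_continuous.
Qed.

(** Bridges the product topology and the product sigma-algebra by second countability: [U] is the
    union of the countably many boxes [bx k] with rational centre that it contains, and the preimage
    of a box is a finite intersection of coordinate conditions. *)
Lemma measurable_open_preimage d0 (X : measurableType d0) (D : set X)
    (u : X -> R) (v : X -> 'rV[R]_d) (U : set (R * 'rV[R]_d)) :
  measurable D -> measurable_fun D u ->
  (forall i, measurable_fun D (fun z => v z ord0 i)) -> open U ->
  measurable (D `&` [set z | U (u z, v z)]).
Proof.
move=> mD mu mv oU.
pose bx (k : rat * {ffun 'I_d -> rat} * nat) : set (R * 'rV[R]_d) :=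
  [set y : R * 'rV[R]_d | `|y.1 - ratr k.1.1| < k.2.+1%:R^-1 /\
    forall i, `|y.2 ord0 i - ratr (k.1.2 i)| < k.2.+1%:R^-1].
have -> : D `&` [set z | U (u z, v z)] =
    \bigcup_(k in [set: rat * {ffun 'I_d -> rat} * nat])
      (D `&` [set z | bx k (u z, v z) /\ bx k `<=` U]).
  apply/seteqP; split => [z [Dz Uz]|z [k _ [Dz [bz bU]]]]; last first.
    by split => //; exact: bU.
  move: (oU); rewrite openE => /(_ _ Uz)/nbhs_ballP[e /= e0 eU].
  (* Two points of one box are within twice its radius in each coordinate, so a radius below [e / 2]
     keeps the box around [z] inside the ball of radius [e]. *)
  have [n ne] : exists n, (n.+1%:R^-1 : R) < e / 2.
    have e2 : 0 < e / 2 by rewrite divr_gt0.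
    by have [n] := ltr_add_invr e2 ; rewrite add0r; exists n.
  have n0 : (0 : R) < n.+1%:R^-1 by rewrite invr_gt0.
  have close (x q y : R) : `|x - q| < n.+1%:R^-1 -> `|y - q| < n.+1%:R^-1 -> `|x - y| < e.
    move=> xq yq; rewrite (_ : x - y = (x - q) - (y - q)); last by ring.
    apply: (le_lt_trans (ler_normB _ _)); rewrite [e]splitr.
    by apply: ltrD; [exact: lt_trans xq ne | exact: lt_trans yq ne].
  have rat_near (r : R) : exists q : rat, `|r - ratr q| < n.+1%:R^-1.
    have : r - n.+1%:R^-1 < r + n.+1%:R^-1.
      by rewrite ltrBlDr -addrA ltrDl addr_gt0.
    move=> /rat_in_itvoo[q]; rewrite in_itv/= => /andP[q1 q2].
    by exists q; rewrite ltr_distlC q1 q2.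
  have [q1 hq1] := rat_near (u z).
  have [q2 hq2] := choice (fun i => rat_near (v z ord0 i)).
  exists (q1, [ffun i => q2 i], n) => //; split => //; split.
    by split => //= i; rewrite ffunE.
  move=> y [/= y1 y2]; apply: eU; split => /=.
    exact: close hq1 y1.
  split => // i j; rewrite ord1; have := y2 j; rewrite ffunE => y2j.
  exact: close (hq2 j) y2j.
apply: countable_bigcupT_measurable; first exact: countableP.
move=> k; have [bU|nbU] := pselect (bx k `<=` U); last first.
  rewrite (_ : _ `&` _ = set0); first exact: measurable0.
  by apply/seteqP; split => z // [_ [_]].
have mB (r c : R) (h : X -> R) : measurable_fun D h ->
    measurable (D `&` [set z | `|h z - c| < r]).
  move=> mh; have mh' : measurable_fun D (fun z => `|h z - c|).
    apply: measurableT_comp => //; apply: measurable_funB => //; exact: measurable_cst.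
  have := mh' mD `]-oo, r[%classic (measurable_itv _).
  by congr measurable; apply/seteqP; split => z /= [Dz]; rewrite in_itv/=.
rewrite (_ : _ `&` _ =
   (D `&` [set z | `|u z - ratr k.1.1| < k.2.+1%:R^-1]) `&`
   \bigcap_(i in [set: 'I_d])
     (D `&` [set z | `|v z ord0 i - ratr (k.1.2 i)| < k.2.+1%:R^-1])); last first.
  apply/seteqP; split => z /=.
    by move=> [Dz [[h1 h2] _]]; split => // i _; split => //; exact: h2.
  by move=> [[Dz h1] h2]; split => //; split => //; split => // i; have [] := h2 i I.
apply: measurableI; first exact: mB.
by apply: fin_bigcap_measurable => [|i _]; [exact: finite_finset | exact: mB].
Qed.

Lemma measurable_fun_Rd d0 (X : measurableType d0) (D : set X) (v : X -> Rd R d) :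
  (forall i, measurable_fun D (fun z => (v z : 'rV[R]_d) ord0 i)) ->
  measurable_fun D v.
Proof.
move=> mv mD.
apply: (@measurability _ _ _ _ D v open erefl _ mD) => _ [U oU <-].
have oU' : open [set y : R * 'rV[R]_d | U y.2].
  by apply: (@open_comp _ _ snd U) => // y _; exact: cvg_snd.
exact: (@measurable_open_preimage _ X D (cst 0) v _ mD (measurable_cst _) mv oU').
Qed.

Lemma measurable_within_continuous (D : set (R * 'rV[R]_d)) (F : R * 'rV[R]_d -> R) :
  measurable (D : set (R * Rd R d)) -> {within D, continuous F} ->
  measurable_fun (D : set (R * Rd R d)) F.
Proof.
move=> mD cF.
apply: (measurability _ (RGenOpens.measurableE R)) => _ [_ [a [b ->]] <-].
have /continuousP oF := cF.
have /open_subspaceP[V oV VD] : open (F @^-1` `]a, b[%classic : set (subspace D)).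
  by apply: oF; exact: interval_open.
rewrite setIC -VD setIC.
have -> : D `&` V = (D : set (R * Rd R d)) `&` [set z | V (z.1, z.2)].
  by apply/seteqP; split => -[].
apply: measurable_open_preimage => //.
  exact: measurable_funS measurable_fst.
by move=> i; apply: measurable_funS (measurableT_comp (measurable_coord i) measurable_snd).
Qed.

End borel_coordinates.

(** * Calculus of the logistic test functions *)

(** Both difference quotients coincide, which reduces partial derivatives in space to one-variable
    rules. *)
Lemma is_derive_line (R : realType) (V W : normedModType R) (f : V -> W) (x v : V) df :
  is_derive (0 : R) 1 (fun h : R => f (h *: v + x)) df -> is_derive x v f df.
Proof.
move=> [fd fv].
have E : (fun h : R => h^-1 *:
      (((fun h : R => f (h *: v + x)) \o shift 0) (h *: 1) - f (0 *: v + x)))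
   = (fun h : R => h^-1 *: ((f \o shift x) (h *: v) - f x)).
  by apply/funext => h /=; rewrite addr0 scale0r add0r [h *: 1]mulr1.
split; first by move: fd; rewrite /derivable E.
by move: fv; rewrite /derive E.
Qed.

Lemma is_derive_expR_affine (R : realType) (q v : R) (t : R) :
  is_derive t 1 (fun h : R => expR (q + h * v)) (v * expR (q + t * v)).
Proof.
have : is_derive t 1 (expR \o (fun h : R => q + h * v)) (expR (q + t * v) * v).
  apply: is_derive1_comp.
  have -> : (fun h : R => q + h * v) = cst q + v \*: id.
    by apply/funext => h; rewrite /= /GRing.add /= /GRing.scale /= mulrC.
  apply: is_derive_eq.
  by rewrite add0r /GRing.scale /= mulr1.
by rewrite mulrC.
Qed.

Lemma mx_norm_le (R : realType) m n (x : 'M[R]_(m, n)) (M : R) :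
  0 <= M -> (forall i j, `|x i j| <= M) -> `|x| <= M.
Proof.
by move=> M0 xM; rewrite [leLHS]/Num.norm /= mx_normrE; apply: bigmax_le.
Qed.

Lemma mx_norm_coord (R : realType) m n (x : 'M[R]_(m, n)) i j : `|x i j| <= `|x|.
Proof.
rewrite [leRHS]/Num.norm /= mx_normrE.
by apply/bigmax_geP; right; exists (i, j).
Qed.

Lemma continuous_mx (R : realType) (X : topologicalType) m n (F : X -> 'M[R]_(m, n)) :
  (forall i j, continuous (fun z => F z i j)) -> continuous F.
Proof.
move=> cF z; apply/cvg_ballP => e e0.
have : \forall y \near z, forall i j, ball (F z i j) e (F y i j).
  apply: filter_forall => i; apply: filter_forall => j.
  by have /cvg_ballP := cF i j z; exact.
by apply: filterS => y h; split.
Qed.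

(** Converts the library derivative into the one-sided form used by [C12b]: the increment is
    re-indexed as [s - t], which tends to 0 without reaching it. *)
Lemma is_derive_within (R : realType) (D : set R) (f : R -> R) (t df : R) :
  is_derive t 1 f df ->
  (fun s => (f s - f t) / (s - t)) @ within (D `\ t) (nbhs t) --> df.
Proof.
move=> [fd fv].
have : (fun h : R => h^-1 *: ((f \o shift t) (h *: 1) - f t)) @ 0^' --> df.
  by rewrite -fv; exact: fd.
move=> cf.
have cs : (fun s => s - t) @ within (D `\ t) (nbhs t) --> (0 : R)^'.
  move=> P nP; have nP' : \forall h \near (0 : R), h != 0 -> P h := nP.
  have ct : (fun s : R => s - t) @ t --> (0 : R).
    by rewrite -(subrr t); apply: cvgB; [exact: cvg_id | exact: cvg_cst].
  change (\forall s \near t, (D `\ t) s -> P (s - t)).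
  have : \forall s \near t, s - t != 0 -> P (s - t) := ct _ nP'.
  apply: filterS => s h [_ st].
  by apply: h; rewrite subr_eq0; apply/eqP.
have := cvg_comp _ _ cs cf.
apply: cvg_trans; apply: near_eq_cvg; near=> s => /=.
by rewrite /GRing.scale /= mulr1 subrK mulrC.
Unshelve. all: by end_near. Qed.

Section logistic.
Context (R : realType) (d : nat).
Variables (l : R) (p0 : R) (p : 'I_d -> R).
Implicit Types (t : R) (x : 'rV[R]_d).

Let E0 t := expR (p0 + t * - l).
Let E k x := expR (p k + x ord0 k * - l).
Let S t x := 1 + E0 t + \sum_(k < d) E k x.

Definition logistic t x : R := (S t x)^-1.
Definition logistic_dt t x : R := l * E0 t * (S t x) ^- 2.
Definition logistic_dx t x : 'rV[R]_d := \row_i (l * E i x * (S t x) ^- 2).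
Definition logistic_dxx t x : 'M[R]_d :=
  \matrix_(i, j) (2 * l ^+ 2 * E i x * E j x * (S t x) ^- 3
                  - (i == j)%:R * l ^+ 2 * E i x * (S t x) ^- 2).

Let E_ge0 k x : 0 <= E k x. Proof. exact: expR_ge0. Qed.

(** Source of all the bounds: the ratios of 1 and of each exponential to [S] lie in [[0, 1]], and
    the derivatives are polynomials in these ratios. *)
Let S_ge t x : [/\ 1 <= S t x, E0 t <= S t x & forall k, E k x <= S t x].
Proof.
have s0 : 0 <= \sum_(k < d) E k x by apply: sumr_ge0 => k _.
have e0 : 0 <= E0 t by exact: expR_ge0.
split; rewrite /S; [lra|lra|move=> k].
rewrite (bigD1 k)//=.
have : 0 <= \sum_(i < d | i != k) E i x by apply: sumr_ge0 => i _.
lra.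
Qed.

Let S_gt0 t x : 0 < S t x.
Proof. by have [h _ _] := S_ge t x; exact: lt_le_trans h. Qed.

Lemma logistic_gt0 t x : 0 < logistic t x.
Proof. by rewrite invr_gt0. Qed.

Lemma logistic_le1 t x : logistic t x <= 1.
Proof. by rewrite invf_le1//; have [] := S_ge t x. Qed.

Let is_derive_S t x : is_derive t 1 (fun s => S s x) (- l * E0 t).
Proof.
have -> : (fun s => S s x) = (fun s => expR (p0 + s * - l)) + cst (1 + \sum_(k < d) E k x).
  by apply/funext => s; rewrite addrfctE /S addrAC addrC.
have h := is_derive_expR_affine p0 (- l) t.
by apply: is_derive_eq; rewrite addr0.
Qed.

Lemma is_derive_logistic_dt t x : is_derive t 1 (logistic ^~ x) (logistic_dt t x).
Proof.
have S0 : S t x != 0 by rewrite gt_eqF.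
apply: (is_derive_eq (is_deriveV (f := fun s => S s x) S0 (is_derive_S t x))).
rewrite /logistic_dt -[LHS]/(- S t x ^- 2 * (- l * E0 t)); ring.
Qed.

Let is_derive_E j k x : is_derive x (evec R j) (E k) (- l * (k == j)%:R * E k x).
Proof.
apply: is_derive_line.
have -> : (fun h : R => E k (h *: evec R j + x))
    = (fun h => expR ((p k + x ord0 k * - l) + h * (- l * (k == j)%:R))).
  apply/funext => h; rewrite /E !mxE eqxx /=; congr expR; ring.
apply: (is_derive_eq (is_derive_expR_affine _ _ _)).
by rewrite mul0r addr0.
Qed.

Let is_derive_Sx j t x : is_derive x (evec R j) (S t) (- l * E j x).
Proof.
have -> : S t = cst (1 + E0 t) + \sum_(k < d) E k.
  by apply/funext => y; rewrite addrfctE fct_sumE.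
have h k := is_derive_E j k x.
apply: is_derive_eq.
rewrite add0r (bigD1 j)//= eqxx mulr1 big1 ?addr0// => k /negbTE ->.
by rewrite mulr0 mul0r.
Qed.

Let is_derive_Vx j t x :
  is_derive x (evec R j) (fun y => (S t y)^-1) (l * E j x * (S t x) ^- 2).
Proof.
have [dS vS] := is_derive_Sx j t x.
have S0 : S t x != 0 by rewrite gt_eqF.
split; first exact: derivableV.
by rewrite deriveV// vS -[LHS]/(- S t x ^- 2 * (- l * E j x)); ring.
Qed.

Lemma is_derive_logistic_dx t x i :
  is_derive x (evec R i) (logistic t) (logistic_dx t x ord0 i).
Proof. by rewrite mxE; exact: is_derive_Vx. Qed.

Lemma is_derive_logistic_dxx t x i j :
  is_derive x (evec R j) (fun y => logistic_dx t y ord0 i) (logistic_dxx t x i j).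
Proof.
have -> : (fun y => logistic_dx t y ord0 i) =
    l \*: (E i * ((fun y => (S t y)^-1) ^+ 2)).
  apply/funext => y; rewrite mxE -exprVn -mulrA.
  by rewrite /= mulrfctE exprfctE.
have h1 := is_derive_Vx j t x; have h2 := is_derive_E j i x.
apply: is_derive_eq.
rewrite mxE exprfctE /GRing.scale /= expr1 -!exprVn; ring.
Qed.

Let continuous_E k : continuous (fun z : R * 'rV[R]_d => E k z.2).
Proof.
move=> z; apply: (@continuous_comp _ _ _ (fun z : R * 'rV[R]_d => p k + z.2 ord0 k * - l) expR).
  apply: cvgD; first exact: cvg_cst.
  apply: cvgM; last exact: cvg_cst.
  by apply: (@continuous_comp _ _ _ snd (fun x : 'rV[R]_d => x ord0 k));
    [exact: cvg_snd | exact: coord_continuous].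
exact: continuous_expR.
Qed.

Let continuous_E0 : continuous (fun z : R * 'rV[R]_d => E0 z.1).
Proof.
move=> z; apply: (@continuous_comp _ _ _ (fun z : R * 'rV[R]_d => p0 + z.1 * - l) expR).
  apply: cvgD; first exact: cvg_cst.
  by apply: cvgM; [exact: cvg_fst | exact: cvg_cst].
exact: continuous_expR.
Qed.

Let continuous_V : continuous (fun z : R * 'rV[R]_d => (S z.1 z.2)^-1).
Proof.
move=> z; apply: cvgV; first by rewrite gt_eqF.
apply: cvgD; first by apply: cvgD; [exact: cvg_cst | exact: continuous_E0].
apply: cvg_big; first exact: add_continuous.
by move=> i _; exact: continuous_E.
Qed.

Lemma logistic_continuous : continuous (fun z : R * 'rV[R]_d => logistic z.1 z.2).
Proof. exact: continuous_V. Qed.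

Let ratio_bound (a t : R) x : 0 <= a -> a <= S t x -> 0 <= a * (S t x)^-1 <= 1.
Proof.
move=> a0 aS; rewrite mulr_ge0 ?invr_ge0 ?(ltW (S_gt0 _ _))//=.
by rewrite ler_pdivrMr ?mul1r.
Qed.

Lemma logistic_C12b T : 0 < l ->
  C12b T logistic logistic_dt logistic_dx logistic_dxx.
Proof.
move=> l0; split.
  by move=> t x _; apply: is_derive_within; exact: is_derive_logistic_dt.
split; first by move=> t x i _; exact: is_derive_logistic_dx.
split; first by move=> t x i j _; exact: is_derive_logistic_dxx.
split.
  (* One constant for all four bounds: values are at most 1, first derivatives at most [l], and a
     Hessian entry is a difference of terms bounded by [2 * l ^+ 2] and [l ^+ 2]. *)
  exists (1 + l + 3 * l ^+ 2) => t x _.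
  have [S1 SE0 SE] := S_ge t x.
  have l2 : 0 <= l ^+ 2 by exact: sqr_ge0.
  have /andP[v0 v1] : 0 <= 1 * (S t x)^-1 <= 1 by apply: ratio_bound.
  rewrite mul1r in v0 v1.
  have /andP[e0 e1] : 0 <= E0 t * (S t x)^-1 <= 1 by apply: ratio_bound => //; exact: expR_ge0.
  have eE k : 0 <= E k x * (S t x)^-1 <= 1 by apply: ratio_bound.
  have M0 : 0 <= 1 + l + 3 * l ^+ 2 by lra.
  have mul01 (a b : R) : 0 <= a <= 1 -> 0 <= b <= 1 -> 0 <= a * b <= 1.
    by move=> /andP[a0 a1] /andP[b0 b1]; rewrite mulr_ge0//= mulr_ile1.
  have vv : 0 <= (S t x)^-1 <= 1 by apply/andP.
  split; [|split; [|split]].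
  - rewrite /logistic ger0_norm//; lra.
  - rewrite /logistic_dt.
    rewrite (_ : l * E0 t * S t x ^- 2 = l * (E0 t * (S t x)^-1 * (S t x)^-1)); last first.
      by rewrite -exprVn; ring.
    have /andP[h0 h1] := mul01 _ _ (introT andP (conj e0 e1)) vv.
    rewrite ger0_norm; last by rewrite mulr_ge0// ltW.
    have : l * (E0 t * (S t x)^-1 * (S t x)^-1) <= l * 1 by rewrite ler_wpM2l// ltW.
    lra.
  - apply: mx_norm_le => // i j; rewrite mxE.
    rewrite (_ : l * E j x * S t x ^- 2 = l * (E j x * (S t x)^-1 * (S t x)^-1)); last first.
      by rewrite -exprVn; ring.
    have /andP[h0 h1] := mul01 _ _ (eE j) vv.
    rewrite ger0_norm; last by rewrite mulr_ge0// ltW.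
    have : l * (E j x * (S t x)^-1 * (S t x)^-1) <= l * 1 by rewrite ler_wpM2l// ltW.
    lra.
  - apply: mx_norm_le => // i j; rewrite mxE.
    have /andP[h0 h1] := mul01 _ _ (mul01 _ _ (eE i) (eE j)) vv.
    have /andP[k0 k1] : 0 <= (i == j)%:R * (E i x * (S t x)^-1 * (S t x)^-1) <= 1.
      apply: (mul01); last exact: mul01 (eE i) vv.
      by case: (i == j) => /=; rewrite ?lexx ?ler01.
    rewrite (_ : _ - _ = l ^+ 2 * (2 * (E i x * (S t x)^-1 * (E j x * (S t x)^-1) * (S t x)^-1)
       - (i == j)%:R * (E i x * (S t x)^-1 * (S t x)^-1))); last first.
      by rewrite -!exprVn; ring.
    rewrite normrM (ger0_norm l2) mulrC.
    apply: (@le_trans _ _ (3 * l ^+ 2)); last by lra.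
    by apply: ler_wpM2r => //; rewrite ler_norml; apply/andP; split; lra.
have cV2 : continuous (fun z : R * 'rV[R]_d => (S z.1 z.2) ^- 2).
  rewrite (_ : (fun z : R * 'rV[R]_d => _) =
      (fun z => (S z.1 z.2)^-1 * (S z.1 z.2)^-1)); last first.
    by apply/funext => z; rewrite -exprVn expr2.
  by move=> z; apply: cvgM; exact: continuous_V.
have cV3 : continuous (fun z : R * 'rV[R]_d => (S z.1 z.2) ^- 3).
  rewrite (_ : (fun z : R * 'rV[R]_d => _) =
      (fun z => (S z.1 z.2) ^- 2 * (S z.1 z.2)^-1)); last first.
    by apply/funext => z; rewrite -!exprVn exprSr.
  by move=> z; apply: cvgM; [exact: cV2 | exact: continuous_V].
split; first exact: continuous_subspaceT continuous_V.
split.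
  apply: continuous_subspaceT => z; apply: cvgM; last exact: cV2.
  by apply: cvgM; [exact: cvg_cst | exact: continuous_E0].
split; apply: continuous_subspaceT; apply: continuous_mx => i j.
  rewrite (_ : (fun z : R * 'rV[R]_d => _) =
    (fun z => l * E j z.2 * (S z.1 z.2) ^- 2)); last by apply/funext => z; rewrite mxE.
  move=> z; apply: cvgM; last exact: cV2.
  by apply: cvgM; [exact: cvg_cst | exact: continuous_E].
rewrite (_ : (fun z : R * 'rV[R]_d => _) =
    (fun z => 2 * l ^+ 2 * E i z.2 * E j z.2 * (S z.1 z.2) ^- 3
                  - (i == j)%:R * l ^+ 2 * E i z.2 * (S z.1 z.2) ^- 2)); last first.
  by apply/funext => z; rewrite mxE.
move=> z; apply: cvgB.
  apply: cvgM; last exact: cV3.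
  apply: cvgM; last exact: continuous_E.
  by apply: cvgM; [exact: cvg_cst | exact: continuous_E].
apply: cvgM; last exact: cV2.
by apply: cvgM; [exact: cvg_cst | exact: continuous_E].
Qed.

End logistic.

(** * Smooth test functions determine finite measures *)

Section orthants.
Context (R : realType) (d : nat).

Definition orthant (a0 : R) (a : 'I_d -> R) : set (R * Rd R d) :=
  [set z | a0 <= z.1 /\ forall k, a k <= (z.2 : 'rV[R]_d) ord0 k].

(* The steepness N^2 beats the offset N off the orthant, while on its closed
   boundary the offset alone forces the exponentials to vanish. *)
Definition soft_orthant (a0 : R) (a : 'I_d -> R) (n : nat) :=
  logistic (n.+1%:R ^+ 2) (n.+1%:R ^+ 2 * a0 - n.+1%:R)
    (fun k => n.+1%:R ^+ 2 * a k - n.+1%:R).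

Let cvg_expRN : expR (- (n.+1%:R : R)) @[n --> \oo] --> (0 : R).
Proof. by have := @cvgn_expR R; rewrite -(cvg_shiftS (fun n => expR (- n%:R))). Qed.

Let cvg_in (a s : R) : a <= s ->
  expR (n.+1%:R ^+ 2 * a - n.+1%:R + s * - n.+1%:R ^+ 2) @[n --> \oo] --> (0 : R).
Proof.
move=> ale; apply: (@squeeze_cvgr _ _ _ _ (cst 0) (fun n => expR (- n.+1%:R))).
- apply: nearW => n; rewrite expR_ge0/= ler_expR.
  have : 0 <= n.+1%:R ^+ 2 * (s - a) by rewrite mulr_ge0 ?sqr_ge0 ?subr_ge0.
  by lra.
- exact: cvg_cst.
- exact: cvg_expRN.
Qed.

Let cvg_out (a s : R) : s < a ->
  (expR (n.+1%:R ^+ 2 * a - n.+1%:R + s * - n.+1%:R ^+ 2))^-1 @[n --> \oo] --> (0 : R).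
Proof.
move=> sa; apply: (@squeeze_cvgr _ _ _ _ (cst 0) (fun n => expR (- n.+1%:R))).
(* Writing [N] for [n.+1], the inverse has exponent [N - (a - s) * N ^+ 2], which is at most [- N]
   as soon as [(a - s) * N] is at least 2. *)
- have [k ck] : exists k : nat, 2 < (a - s) * k%:R.
    have as0 : 0 < a - s by rewrite subr_gt0.
    have := @archi_boundP R (2 / (a - s)); rewrite divr_ge0 ?(ltW as0)// => /(_ isT).
    by rewrite ltr_pdivrMr// mulrC => h; exists (Num.bound (2 / (a - s))).
  exists k => // n /= kn; rewrite -expRN expR_ge0/= ler_expR.
  have kn' : (k%:R : R) <= n.+1%:R by rewrite ler_nat; exact: leq_trans kn _.
  set N := (n.+1%:R : R) in kn' *.
  have N0 : 0 < N by rewrite ltr0n.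
  have h : 2 <= (a - s) * N.
    apply: (le_trans (ltW ck)); apply: ler_wpM2l kn'.
    by rewrite subr_ge0 ltW.
  have : 2 * N <= (a - s) * N * N by rewrite ler_wpM2r// ltW.
  by rewrite expr2; lra.
- exact: cvg_cst.
- exact: cvg_expRN.
Qed.

Lemma cvg_soft_orthant a0 a (z : R * Rd R d) :
  soft_orthant a0 a n z.1 z.2 @[n --> \oo] --> (\1_(orthant a0 a) z : R).
Proof.
rewrite /soft_orthant /logistic indicE.
have [zO|zO] := boolP (z \in _).
  move: zO; rewrite inE => -[h0 h]; rewrite -[X in _ --> X]invr1.
  apply: cvgV; first exact: oner_neq0.
  rewrite -[X in _ --> X]addr0; apply: cvgD.
    rewrite -[X in _ --> X]addr0; apply: cvgD; first exact: cvg_cst.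
    exact: cvg_in.
  rewrite [X in _ --> X](_ : _ = \sum_(k < d) (0 : R)); last by rewrite big1.
  apply: cvg_big; first exact: add_continuous.
  by move=> k _; exact: cvg_in.
pose e0 n : R := expR (n.+1%:R ^+ 2 * a0 - n.+1%:R + z.1 * - n.+1%:R ^+ 2).
pose e n k : R := expR (n.+1%:R ^+ 2 * a k - n.+1%:R + (z.2 : 'rV[R]_d) ord0 k * - n.+1%:R ^+ 2).
have e0p n : 0 < e0 n by exact: expR_gt0.
have ep n k : 0 < e n k by exact: expR_gt0.
(* One violated coordinate suffices: [w] will be its exponential, a lower bound of the denominator
   that tends to infinity. *)
suff [w [ws wp wc]] : exists w : nat -> R,
    [/\ forall n, w n <= 1 + e0 n + \sum_(k < d) e n k, forall n, 0 < w n &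
      (w n)^-1 @[n --> \oo] --> (0 : R)].
  apply: (@squeeze_cvgr _ _ _ _ (cst 0) (fun n => (w n)^-1)) => //; last exact: cvg_cst.
  apply: nearW => n /=.
  have S0 : 0 < 1 + e0 n + \sum_(k < d) e n k by apply: lt_le_trans (ws n).
  apply/andP; split; first by rewrite invr_ge0 ltW.
  by rewrite lef_pV2 ?posrE.
have s0 n : 0 <= \sum_(k < d) e n k by apply: sumr_ge0 => k _; exact: ltW.
have [h0|h0] := leP a0 z.1; last first.
  exists e0; split => //; last exact: cvg_out.
  by move=> n; have := s0 n; lra.
have /existsNP[k /negP] : ~ (forall k, a k <= (z.2 : 'rV[R]_d) ord0 k).
  by move=> h; move/negP: zO; apply; rewrite inE.
rewrite -ltNge => hk; exists (e ^~ k); split => //; last exact: cvg_out.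
move=> n; rewrite (bigD1 k)//=.
have : 0 <= \sum_(i < d | i != k) e n i by apply: sumr_ge0 => i _; exact: ltW.
by have := e0p n; lra.
Qed.

Lemma measurable_orthant a0 a : measurable (orthant a0 a).
Proof.
rewrite (_ : orthant a0 a = (fst @^-1` `[a0, +oo[%classic) `&`
    \bigcap_(k in [set: 'I_d])
      ((fun z : R * Rd R d => (z.2 : 'rV[R]_d) ord0 k) @^-1` `[a k, +oo[%classic)).
  apply: measurableI.
    by rewrite -[X in measurable X]setTI; apply: measurable_fst.
  apply: fin_bigcap_measurable => [|k _]; first exact: finite_finset.
  rewrite -[X in measurable X]setTI.
  by apply: (measurableT_comp (measurable_coord (R := R) k) measurable_snd).
apply/seteqP; split => z /=; rewrite in_itv/= andbT.
  by move=> [h0 h]; split => // k _ /=; rewrite in_itv/= andbT.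
by move=> [h0 h]; split => // k; have := h k I; rewrite /= in_itv/= andbT.
Qed.

Let ex_bound (z : R * 'rV[R]_d) : exists n : nat,
  - n%:R <= z.1 /\ forall k, - n%:R <= z.2 ord0 k.
Proof.
exists (Num.bound (`|z.1| + `|z.2|)).
have := @archi_boundP R (`|z.1| + `|z.2|); rewrite addr_ge0// => /(_ isT) h.
split => [|k].
  rewrite lerNl; apply: (le_trans (ler_norm _)); rewrite normrN.
  by apply: ltW; apply: le_lt_trans h; rewrite lerDl.
rewrite lerNl; apply: (le_trans (ler_norm _)); rewrite normrN.
apply: ltW; apply: le_lt_trans h; apply: (@le_trans _ _ `|z.2|); last by rewrite lerDr.
exact: mx_norm_coord.
Qed.

Let orthants := [set B | exists a0 a, B = orthant a0 a].

(** A closed half-space in one coordinate is a countable union of orthants. Hence on [X], the same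
    set with the sigma-algebra generated by orthants, both components are measurable, and so is the
    identity into the Borel product. *)
Lemma sub_sigma_orthants (E : set (R * Rd R d)) : measurable E -> <<s orthants >> E.
Proof.
pose X := g_sigma_algebraType orthants.
have ort a0 a : measurable (orthant a0 a : set X).
  by apply: sub_sigma_algebra; exists a0, a.
have mt : measurable_fun setT (fun z : X => z.1).
  apply: (measurability _ (RGenCInfty.measurableE R)) => _ [_ [r ->] <-].
  rewrite (_ : _ `&` _ = \bigcup_n orthant r (fun=> - n%:R)).
    by apply: bigcupT_measurable => n; exact: ort.
  apply/seteqP; split => [z [_ /=]|z [n _ [h _]] /=]; rewrite in_itv/= andbT.
    by move=> rz; have [n [_ hn]] := ex_bound z; exists n.
  by split.
have mx : measurable_fun setT (fun z : X => z.2 : Rd R d).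
  apply: measurable_fun_Rd => i.
  apply: (measurability _ (RGenCInfty.measurableE R)) => _ [_ [r ->] <-].
  rewrite (_ : _ `&` _ = \bigcup_n orthant (- n%:R) (fun k => if k == i then r else - n%:R)).
    by apply: bigcupT_measurable => n; exact: ort.
  apply/seteqP; split => [z [_ /=]|z [n _ [_ h]] /=]; rewrite in_itv/= andbT.
    move=> rz; have [n [h hn]] := ex_bound z; exists n => //; split => // k.
    by case: eqP => [->|_].
  by split => //; have := h i; rewrite eqxx.
move=> mE; have := measurable_fun_pair mt mx measurableT mE.
rewrite setTI; congr (<<s orthants >> _).
by apply/seteqP; split => -[].
Qed.

(** Dominated convergence along [soft_orthant] carries the equality of integrals to orthants, a
    generating pi-system that exhausts the space. The logistic functions are global in time, so the
    measures agree off [[0, T]] as well. *)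
Lemma finite_measure_eq_C12b (T : R) (m1 m2 : {measure set (R * Rd R d)%type -> \bar R}) :
  (m1 setT < +oo)%E -> (m2 setT < +oo)%E ->
  (forall psi Dt Dx Hx, C12b T psi Dt Dx Hx ->
     \int[m1]_z psi z.1 z.2 = \int[m2]_z psi z.1 z.2) ->
  forall E, measurable E -> m1 E = m2 E.
Proof.
move=> f1 f2 m12 E mE.
have l0 n : 0 < (n.+1%:R : R) ^+ 2 by rewrite exprn_gt0.
have psi01 n a0 a (z : R * Rd R d) : 0 <= soft_orthant a0 a n z.1 z.2 <= 1.
  by rewrite /soft_orthant logistic_le1 ltW// logistic_gt0.
have mpsi n a0 a : measurable_fun setT
    (fun z : R * Rd R d => soft_orthant a0 a n z.1 z.2).
  by apply: measurable_within_continuous => //; exact/continuous_subspaceT/logistic_continuous.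
have bpsi n a0 a : bmeas setT (fun z : R * Rd R d => soft_orthant a0 a n z.1 z.2).
  split => //; exists 1 => z _; have /andP[h0 h1] := psi01 n a0 a z.
  by rewrite ger0_norm.
have lim (m : {measure set (R * Rd R d)%type -> \bar R}) a0 a : (m setT < +oo)%E ->
    (\int[m]_z (soft_orthant a0 a n z.1 z.2)%:E)%E @[n --> \oo] --> m (orthant a0 a).
  move=> fm; have -> : m (orthant a0 a) = (\int[m]_z (\1_(orthant a0 a) z : R)%:E)%E.
    by rewrite integral_indic ?setIT//; exact: measurable_orthant.
  pose f_ n (z : R * Rd R d) := (soft_orthant a0 a n z.1 z.2)%:E.
  pose f (z : R * Rd R d) := (\1_(orthant a0 a) z : R)%:E.
  have h1 n : measurable_fun setT (f_ n) by exact/measurable_EFinP.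
  have h2 : measurable_fun setT f.
    by apply/measurable_EFinP/measurable_indic; exact: measurable_orthant.
  have h3 : {ae m, forall z, setT z -> f_ ^~ z @ \oo --> f z}.
    apply: aeW => z _; apply: cvg_EFin; first exact: nearW.
    exact: cvg_soft_orthant.
  have h4 := bmeas_integrable measurableT fm (bmeas_cst setT (1 : R)).
  have h5 : {ae m, forall z n, setT z -> `|f_ n z|%E <= (EFin \o cst (1%R : R)) z}%E.
    apply: aeW => z n _; rewrite lee_fin; have /andP[k0 k1] := psi01 n a0 a z.
    by rewrite ger0_norm.
  by have [] := dominated_convergence measurableT h1 h2 h3 h4 h5.
have eqO a0 a : m1 (orthant a0 a) = m2 (orthant a0 a).
  apply: (cvg_unique _ (lim m1 a0 a f1)) => //=.
  rewrite (_ : (fun n => _) = fun n =>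
      (\int[m2]_z (soft_orthant a0 a n z.1 z.2)%:E)%E); first exact: lim.
  apply/funext => n.
  have I (m : {measure set (R * Rd R d)%type -> \bar R}) : (m setT < +oo)%E ->
      (\int[m]_z (soft_orthant a0 a n z.1 z.2)%:E)%E =
      (\int[m]_z soft_orthant a0 a n z.1 z.2)%:E.
    move=> fm; rewrite /Rintegral fineK//.
    by apply: integrable_fin_num => //; exact: bmeas_integrable.
  by rewrite !I// (m12 _ _ _ _ (logistic_C12b _ _ T (l0 n))).
have EB : <<s orthants >> E by exact: sub_sigma_orthants.
apply: (@g_sigma_algebra_measure_unique _ R _ orthants _
  (fun n => orthant (- n%:R) (fun=> - n%:R))) EB.
- by move=> _ [a0 [a ->]]; exact: measurable_orthant.
- by move=> n; exists (- n%:R), (fun=> - n%:R).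
- apply/seteqP; split => // z _; have [n [h0 h]] := ex_bound z; by exists n.
- move=> _ _ [a0 [a ->]] [b0 [b ->]]; exists (Num.max a0 b0), (fun k => Num.max (a k) (b k)).
  apply/seteqP; split => z /=.
    by move=> [[h0 h] [h0' h']]; split => [|k]; rewrite ge_max ?h0 ?h0' ?h ?h'.
  move=> [h0 h]; split; split => [|k].
  + by move: h0; rewrite ge_max => /andP[].
  + by have := h k; rewrite ge_max => /andP[].
  + by move: h0; rewrite ge_max => /andP[].
  + by have := h k; rewrite ge_max => /andP[].
- by move=> _ [a0 [a ->]]; exact: eqO.
- move=> n; apply: le_lt_trans f1; apply: le_measure; rewrite ?inE//.
  exact: measurable_orthant.
Qed.

End orthants.

(** * Construction of the measure mu_t(dx) dt and its Fubini formula *)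

Section clamp.
Context (R : realType) (T : R).
Hypothesis T0 : 0 <= T.

Definition clamp (t : R) : R := Num.max 0 (Num.min t T).

Lemma clamp_itv t : clamp t \in `[0, T].
Proof. by rewrite in_itv/= le_max lexx/= ge_max T0/= ge_min lexx orbT. Qed.

Lemma clampE t : t \in `[0, T] -> clamp t = t.
Proof. by rewrite in_itv/= => /andP[t0 tT]; rewrite /clamp min_l// max_r. Qed.

Lemma measurable_clamp : measurable_fun setT clamp.
Proof.
apply: measurable_maxr; first exact: measurable_cst.
by apply: measurable_minr; [exact: measurable_id | exact: measurable_cst].
Qed.

End clamp.

Section mixture.
Context (R : realType) (d : nat) (T : R) (mu : R -> PRd R d).
Hypotheses (T0 : 0 < T) (mmu : forall B : set (Rd R d), measurable B ->
  measurable_fun `[0, T] (fun t : R => mu t B)).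

Let time_space := measurableTypeR R.

(* Clamping the time extends the kernel from [0, T] to the whole line. *)
Let ker_mu (t : time_space) : {measure set (Rd R d) -> \bar R} := mu (clamp T t).

Let ker_muE t : t \in `[0, T] -> ker_mu t = mu t :> (set (Rd R d) -> \bar R).
Proof. by move=> tT; rewrite /ker_mu clampE. Qed.

Let measurable_ker_mu U : measurable U -> measurable_fun [set: time_space] (ker_mu ^~ U).
Proof.
move=> mU; apply: (@measurable_comp _ _ _ _ _ _ `[0, T] (fun t => mu t U)) => //.
- by move=> _ [t _ <-]; exact: clamp_itv (ltW T0) t.
- exact: mmu.
- exact: measurable_clamp.
Qed.

HB.instance Definition _ :=
  isKernel.Build _ _ _ _ _ ker_mu measurable_ker_mu.

Let ker_mu_prob t : ker_mu t [set: Rd R d] = 1%E.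
Proof. exact: probability_setT. Qed.

HB.instance Definition _ := Kernel_isProbability.Build _ _ _ _ _ ker_mu ker_mu_prob.

Let mT : measurable (`[0, T]%classic : set time_space). Proof. exact: measurable_itv. Qed.

(** Lebesgue measure on [[0, T]] as a constant kernel with one-point source, so that the mixture is
    a composition of kernels and its Tonelli formula an instance of [integral_kcomp]. *)
Let time (_ : unit) : {measure set time_space -> \bar R} :=
  mrestr lebesgue_measure mT.

Let measurable_time U : measurable U -> measurable_fun [set: unit] (time ^~ U).
Proof. by move=> _; exact: measurable_cst. Qed.

HB.instance Definition _ := isKernel.Build _ _ _ _ _ time measurable_time.

Let lebT : (lebesgue_measure (`[0%R, T]%classic : set R) < +oo)%E.
Proof. by rewrite lebesgue_measure_itv/=; case: ifP => _; rewrite ?oppr0 ltry. Qed.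

Let time_uub : measure_fam_uub time.
Proof.
have /fineK h : lebesgue_measure (`[0%R, T]%classic : set R) \is a fin_num.
  by rewrite ge0_fin_numE.
exists (fine (lebesgue_measure (`[0%R, T]%classic : set R)) + 1) => x.
have -> : time x setT = lebesgue_measure (`[0%R, T]%classic : set R).
  by rewrite -[LHS]/(lebesgue_measure (setT `&` `[0%R, T]%classic)) setTI.
by rewrite -h lte_fin ltrDl.
Qed.

HB.instance Definition _ := Kernel_isFinite.Build _ _ _ _ _ time time_uub.

Let mpair (t : R) : measurable_fun [set: Rd R d] (pair t : Rd R d -> R * Rd R d).
Proof. exact: pair1_measurable. Qed.

(** The product of the Dirac mass at [t] with mu_t: the second kernel must keep the time coordinate,
    which composition would otherwise integrate out. *)
Let slice (z : unit * time_space) : {measure set (R * Rd R d)%type -> \bar R} :=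
  measure_function_pushforward__canonical__measure_function_Measure (ker_mu z.2) (mpair z.2).

Let measurable_slice U : measurable U ->
  measurable_fun [set: unit * time_space] (slice ^~ U).
Proof.
move=> mU; have := @measurable_fun_xsection_finite_kernel _ _ _ _ _ ker_mu U.
rewrite inE => /(_ mU) h.
apply: (eq_measurable_fun (fun z : unit * time_space => ker_mu z.2 (xsection U z.2))).
  by move=> z _; congr (ker_mu _ _); apply/seteqP; split => y /=; rewrite /xsection /= ?inE.
exact: measurableT_comp h measurable_snd.
Qed.

HB.instance Definition _ := isKernel.Build _ _ _ _ _ slice measurable_slice.

Let slice_prob z : slice z setT = 1%E.
Proof. exact: ker_mu_prob. Qed.

HB.instance Definition _ := Kernel_isProbability.Build _ _ _ _ _ slice slice_prob.

Definition mixture : {measure set (R * Rd R d)%type -> \bar R} := mkcomp time slice tt.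

Lemma ge0_integral_mixture (f : R * Rd R d -> \bar R) :
  (forall z, 0 <= f z)%E -> measurable_fun setT f ->
  (\int[mixture]_z f z = \int[lebesgue_measure]_(t in `[0%R, T]) \int[mu t]_x f (t, x))%E.
Proof.
move=> f0 mf; rewrite [LHS](integral_kcomp time slice tt f0 mf).
rewrite (@integral_conull _ _ _ (time tt) `[0, T]%classic)//; last first.
  by rewrite -[LHS]/(lebesgue_measure (~` `[0, T]%classic `&` `[0%R, T]%classic))
    setICl measure0.
transitivity (\int[lebesgue_measure]_(t in `[0%R, T]) \int[slice (tt, t)]_z f z)%E.
  apply: eq_measure_integral => A mA AT.
  by rewrite -[LHS]/(lebesgue_measure (A `&` `[0%R, T]%classic)) setIidl.
apply: eq_integral => t tT.
have f0' : {in [set: R * Rd R d], forall z, (0 <= f z)%E} by move=> z _.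
rewrite [LHS](ge0_integral_pushforward (mpair t) (ker_mu t) measurableT mf f0').
by rewrite preimage_setT /comp ker_muE//; move: tT; rewrite inE.
Qed.

Lemma measurable_integral_mixture (f : R * Rd R d -> \bar R) :
  (forall z, 0 <= f z)%E -> measurable_fun setT f ->
  measurable_fun `[0, T] (fun t => \int[mu t]_x f (t, x))%E.
Proof.
move=> f0 mf.
have h := @measurable_fun_integral_finite_kernel _ _ time_space _ _ f ker_mu f0 mf.
apply: eq_measurable_fun (measurable_funTS h) => t; rewrite inE => tT.
by rewrite ker_muE.
Qed.

Lemma mixture_fin : (mixture setT < +oo)%E.
Proof.
have -> : mixture setT = (\int[mixture]_z 1)%E by rewrite integral_cst// mul1e.
rewrite ge0_integral_mixture//.
have I1 t : (\int[mu t]_(x in [set: Rd R d]) 1 = 1)%E.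
  by rewrite integral_cst// mul1e; exact: probability_setT.
under eq_integral do rewrite I1.
by rewrite integral_cst// mul1e.
Qed.

Let D : set (R * Rd R d) := `[0, T] `*` setT.

Let mD : measurable D.
Proof. by apply: measurableX => //; exact: measurable_itv. Qed.

Lemma mixtureC : mixture (~` D) = 0%E.
Proof.
have -> : mixture (~` D) = (\int[mixture]_z (\1_(~` D) z : R)%:E)%E.
  by rewrite integral_indic ?setIT//; exact: measurableC.
rewrite ge0_integral_mixture//; last exact/measurable_EFinP/measurable_indic/measurableC.
apply: integral0_eq => t tT; apply: integral0_eq => x _.
by rewrite indicE memNset//= => -[]; split.
Qed.

Lemma mixture_section (F : R * Rd R d -> R) (t : R) : bmeas D F -> t \in `[0, T] ->
  bmeas setT (fun x : Rd R d => F (t, x)).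
Proof.
move=> [mF [M hM]] tT; split; last by exists M => x _; apply: hM; split.
have : measurable_fun setT (F \_ D) by exact: (proj1 (measurable_restrictT F mD) mF).
move/(measurable_fun_pair2 t); apply: eq_measurable_fun => x _.
by rewrite patchE mem_set.
Qed.

Let ge0_Rintegral_mixture (F : R * Rd R d -> R) : bmeas D F -> (forall z, D z -> 0 <= F z) ->
  bmeas `[0, T] (fun t => \int[mu t]_x F (t, x)) /\
  \int[mixture]_(z in D) F z =
    \int[lebesgue_measure]_(t in `[0, T]) \int[mu t]_x F (t, x).
Proof.
move=> bF F0; have [mF [M hM]] := bF.
pose f : R * Rd R d -> \bar R := EFin \o (F \_ D).
have f0 z : (0 <= f z)%E by rewrite lee_fin; exact: restrict_ge0.
have mf : measurable_fun setT f.
  by apply/measurable_EFinP; exact: (proj1 (measurable_restrictT F mD) mF).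
have If t : t \in `[0, T] -> (\int[mu t]_x f (t, x) = (\int[mu t]_x F (t, x))%:E)%E.
  move=> tT; rewrite /Rintegral fineK.
    by apply: eq_integral => x _; rewrite /f /= patchE mem_set.
  apply: integrable_fin_num => //.
  apply: (bmeas_integrable measurableT) (mixture_section bF tT).
  exact: probability_fin.
split.
  split.
    apply: eq_measurable_fun (measurableT_comp
      (@fine_measurable R setT measurableT) (measurable_integral_mixture f0 mf)).
    by move=> t; rewrite inE => tT /=; rewrite If.
  exists M => t tT; apply: bmeas_Rintegral_le; first exact: mixture_section.
  by move=> x; apply: hM.
rewrite Rintegral_mkcond /Rintegral; congr fine.
rewrite (_ : (\int[mixture]_x _)%E = (\int[mixture]_z f z)%E)//.
rewrite ge0_integral_mixture//.
by apply: eq_integral => t; rewrite inE => tT; rewrite If.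
Qed.

Lemma Rintegral_mixture (F : R * Rd R d -> R) : bmeas D F ->
  bmeas `[0, T] (fun t => \int[mu t]_x F (t, x)) /\
  \int[mixture]_(z in D) F z =
    \int[lebesgue_measure]_(t in `[0, T]) \int[mu t]_x F (t, x).
Proof.
move=> bF; have [mF [M hM]] := bF.
(* Adding this constant makes [F] nonnegative on [D]; the nonnegative case is applied to [F \+ c]
   and to [c], and the results are subtracted. *)
pose c : R * Rd R d -> R := cst `|M|.
have bc : bmeas D c by exact: bmeas_cst.
have bG : bmeas D (F \+ c) by exact: bmeasD.
have G0 z : D z -> 0 <= (F \+ c) z.
  move=> Dz; rewrite /c /= -lerBlDr sub0r.
  have := le_trans (hM _ Dz) (ler_norm M).
  by rewrite ler_norml => /andP[].
have c0 z : D z -> 0 <= c z by rewrite /c /= normr_ge0.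
have [b1 e1] := ge0_Rintegral_mixture bG G0.
have [b2 e2] := ge0_Rintegral_mixture bc c0.
have FE t : t \in `[0, T] -> \int[mu t]_x F (t, x) =
    \int[mu t]_x (F \+ c) (t, x) - \int[mu t]_x c (t, x).
  move=> tT; rewrite -bmeas_RintegralB//.
  - by apply: eq_Rintegral => x _ /=; rewrite addrK.
  - exact: probability_fin.
  - exact: mixture_section bG tT.
  - exact: mixture_section bc tT.
split.
  by apply: bmeas_eq (bmeasB b1 b2) => t tT /=; rewrite FE.
transitivity (\int[mixture]_(z in D) ((F \+ c) z - c z)).
  by apply: eq_Rintegral => z _ /=; rewrite addrK.
rewrite bmeas_RintegralB//; last first.
  by apply: le_lt_trans mixture_fin; apply: le_measure; rewrite ?inE.
rewrite e1 e2 -[LHS](bmeas_RintegralB (m := lebesgue_measure) mT lebT b1 b2).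
by apply: eq_Rintegral => t; rewrite inE => tT; rewrite FE.
Qed.

End mixture.

(** * Image measures, narrow continuity and full support *)

Section pushforward_bounded.
Context d1 d2 (X : measurableType d1) (Y : measurableType d2) (R : realType).
Variables (m : {measure set X -> \bar R}) (phi : X -> Y).
Hypotheses (mfin : (m setT < +oo)%E) (mphi : measurable_fun setT phi).

Definition image_measure : {measure set Y -> \bar R} :=
  measure_function_pushforward__canonical__measure_function_Measure m mphi.

Lemma image_measureE (B : set Y) : image_measure B = m (phi @^-1` B).
Proof. by []. Qed.

Lemma Rintegral_image_measure (D : set Y) (f : Y -> R) :
  measurable D -> bmeas D f ->
  \int[image_measure]_(y in D) f y = \int[m]_(x in phi @^-1` D) f (phi x).
Proof.
move=> mD [mf [M hM]].
have mf' : measurable_fun setT (f \_ D) by exact: (proj1 (measurable_restrictT f mD) mf).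
have mf'' : measurable_fun setT (EFin \o (f \_ D)) by exact/measurable_EFinP.
have If : m.-integrable (phi @^-1` setT) ((EFin \o (f \_ D)) \o phi).
  rewrite preimage_setT; apply: (bmeas_integrable (f := (f \_ D) \o phi) measurableT mfin).
  split; first exact: measurableT_comp mf' mphi.
  exists `|M| => x _ /=; rewrite patchE; case: ifPn => [|_]; last by rewrite normr0.
  by rewrite inE => Dx; exact: le_trans (hM _ Dx) (ler_norm _).
rewrite Rintegral_mkcond [RHS]Rintegral_mkcond /Rintegral.
congr fine; rewrite [LHS](integral_pushforward mphi mf'' If measurableT) preimage_setT.
by apply: eq_integral => x _ /=; rewrite !patchE; congr EFin.
Qed.

End pushforward_bounded.

Section narrow.
Context (R : realType) (d : nat).

(** A basic weak neighbourhood constrains finitely many integrals, each continuous in time on [D];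
    so preimages of weakly open sets are relatively open in [D]. *)
Lemma measurable_narrow (D : set R) (mu : R -> PRd R d) : measurable D ->
  (forall h : 'rV[R]_d -> R, bcont h ->
    {within D, continuous (fun t => Rintegral (mu t) setT h)}) ->
  measurable_fun D (mu : R -> PW R d).
Proof.
move=> mD cmu _.
apply: (@measurability _ _ _ _ D (mu : R -> PW R d) (@weak_open R d) erefl _ mD).
move=> _ [U wU <-]; apply: open_measurable_subspace => //.
rewrite openE; suff h (t : R) : U (mu t) ->
    nbhs_subspace (A := D) t ((mu : R -> PW R d) @^-1` U) by move=> t; exact: h.
move=> Ut.
have [k [s [e [e0 [bs hU]]]]] := wU _ Ut.
have [Dt|nDt] := pselect (D t); last first.
  by rewrite -nbhs_subspace_out => [_ ->|].
rewrite -nbhs_subspace_in//.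
change (\forall t' \near t, D t' -> U (mu t')).
have : \forall t' \near t, forall i : 'I_k, D t' ->
    `|Rintegral (mu t') setT (s i) - Rintegral (mu t) setT (s i)| < e.
  pose P (i : 'I_k) (t' : R) := D t' ->
    `|Rintegral (mu t') setT (s i) - Rintegral (mu t) setT (s i)| < e.
  apply: (@filter_forall R 'I_k P (nbhs t) _) => i.
  have /subspace_continuousP/(_ t Dt)/cvgrPdist_lt/(_ e e0) := cmu _ (bs i (ltn_ord i)).
  move=> H; have : \forall t' \near t, D t' ->
    `|Rintegral (mu t) setT (s i) - Rintegral (mu t') setT (s i)| < e := H.
  by apply: filterS => t' h Dt'; rewrite distrC; exact: h.
by apply: filterS => t' h Dt'; apply: hU => i ik; exact: (h (Ordinal ik) Dt').
Qed.

Definition full_support (m : PRd R d) := forall (x : 'rV[R]_d) (r : R), 0 < r ->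
  (0 < m [set y : Rd R d | (eucl (y - x) < r)%R])%E.

Lemma measurable_open_Rd (U : set 'rV[R]_d) : open U -> measurable (U : set (Rd R d)).
Proof. by move=> oU; exact: sub_sigma_algebra. Qed.

Lemma continuous_eucl (x : 'rV[R]_d) : continuous (fun y : 'rV[R]_d => eucl (y - x)).
Proof.
have cS : continuous (fun y : 'rV[R]_d => \sum_(i < d) ((y - x) ord0 i) ^+ 2).
  apply: continuous_big; first exact: add_continuous.
  move=> i _.
  have cg (c : R) : continuous (fun s : R => (s - c) * (s - c)).
    by move=> s; apply: cvgM; apply: cvgB;
      [exact: cvg_id | exact: cvg_cst | exact: cvg_id | exact: cvg_cst].
  have -> : (fun y : 'rV[R]_d => ((y - x) ord0 i) ^+ 2) =
      (fun s => (s - x ord0 i) * (s - x ord0 i)) \o (fun y : 'rV[R]_d => y ord0 i).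
    by apply/funext => z; rewrite /= !mxE expr2.
  by move=> y; apply: continuous_comp; [exact: coord_continuous | exact: cg].
move=> y; apply: (@continuous_comp _ _ _ _ Num.sqrt); first exact: cS.
exact: sqrt_continuous.
Qed.

Lemma eucl_norm (x : 'rV[R]_d) : `|x| <= eucl x.
Proof.
apply: mx_norm_le; first exact: sqrtr_ge0.
move=> i j; rewrite ord1 -sqrtr_sqr ler_wsqrtr//.
by rewrite (bigD1 j)//= lerDl sumr_ge0// => k _; exact: sqr_ge0.
Qed.

(** The support condition speaks of Euclidean balls, the topology of sup-norm balls; by [eucl_norm]
    the former sit inside the latter of equal radius. *)
Lemma full_support_nbhs (m : PRd R d) (x : 'rV[R]_d) (B : set (Rd R d)) :
  full_support m -> measurable B -> nbhs x B -> (0 < m B)%E.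
Proof.
move=> fs mB /nbhs_ballP[r /= r0 rB]; apply: lt_le_trans (fs x r r0) _.
apply: le_measure; rewrite ?inE//.
  apply: measurable_open_Rd.
  have -> : [set y : 'rV[R]_d | eucl (y - x) < r] =
      (fun y : 'rV[R]_d => eucl (y - x)) @^-1` `]-oo, r[%classic.
    by apply/seteqP; split => y; rewrite /= in_itv.
  apply: open_comp; last exact: interval_open.
  by move=> y _; exact: continuous_eucl.
move=> y /= yr; apply: rB; rewrite -ball_normE /ball_ /= distrC.
exact: le_lt_trans (eucl_norm _) yr.
Qed.

Lemma full_support_eq0 (m : PRd R d) (h : 'rV[R]_d -> R) :
  full_support m -> continuous h ->
  m [set x : Rd R d | h x != 0] = 0%E -> forall x, h x = 0.
Proof.
move=> fs ch h0 x; apply/eqP; apply/negPn/negP => hx.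
have oh : open [set x : 'rV[R]_d | h x != 0].
  by apply: (open_comp (f := h) (D := [set s | s != 0])) => //; exact: open_neq.
have := full_support_nbhs fs (measurable_open_Rd oh) (open_nbhs_nbhs (conj oh hx)).
by rewrite h0 ltxx.
Qed.

Lemma within_slice_continuous (D : set R) (F : R * 'rV[R]_d -> R) t : D t ->
  {within D `*` setT, continuous F} -> continuous (fun x => F (t, x)).
Proof.
move=> Dt /subspace_continuousP cF; suff h (x : 'rV[R]_d) : F (t, y) @[y --> x] --> F (t, x).
  by move=> x; exact: h.
have := cF (t, x) (conj Dt I).
apply: cvg_trans => P; rewrite /= /within /= => hP.
have hp : (fun y : 'rV[R]_d => (t, y)) @ x --> (t, x).
  move=> Q [[A B] [nA nB] AB]; apply: filterS nB => y By.
  by apply: AB; split => //; exact: nbhs_singleton nA.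
have h2 : \forall y \near x, (D `*` [set: 'rV[R]_d]) (t, y) -> P (F (t, y)) := hp _ hP.
change (\forall y \near x, P (F (t, y))).
by apply: filterS h2 => y; exact.
Qed.

End narrow.

Lemma bmeas_comp d1 d2 (X : measurableType d1) (Y : measurableType d2)
    (R : realType) (E : set X) (D : set Y) (h : X -> Y) (F : Y -> R) :
  measurable E -> measurable D -> measurable_fun setT h ->
  (forall x, E x -> D (h x)) -> bmeas D F -> bmeas E (fun x => F (h x)).
Proof.
move=> mE mD mh ED [mF [M hM]]; split; last by exists M => x /ED; exact: hM.
apply: (@measurable_comp _ _ _ _ _ _ D) => //; last exact: measurable_funTS.
by move=> _ [x Ex <-]; exact: ED.
Qed.

(** * Measurability of the coefficients along the flow of measures *)

Section time_space.
Context (R : realType) (d : nat) (A : ptopologicalType) (T : R).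
Hypothesis T0 : 0 < T.

Definition strip : set (R * Rd R d) := `[0, T] `*` setT.
Definition strip_action : set ((R * Rd R d) * Borel A) := strip `*` setT.

Lemma measurable_strip : measurable strip.
Proof. by apply: measurableX => //; exact: measurable_itv. Qed.

Lemma measurable_strip_action : measurable strip_action.
Proof. by apply: measurableX => //; exact: measurable_strip. Qed.

Lemma bmeas_strip_action (F : R * Rd R d -> R) : bmeas strip F ->
  bmeas strip_action (fun z => F z.1).
Proof.
apply: bmeas_comp; [exact: measurable_strip_action | exact: measurable_strip |
  exact: measurable_fst | by move=> z []].
Qed.

Lemma bmeas_within (F : R * 'rV[R]_d -> R) (M : R) :
  {within strip, continuous F} ->
  (forall t x, t \in `[0, T] -> `|F (t, x)| <= M) -> bmeas strip F.
Proof.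
move=> cF hM; split; last by exists M => -[t x] [/= tT _]; exact: hM.
by apply: measurable_within_continuous => //; exact: measurable_strip.
Qed.

Lemma C12b_bmeas psi Dt Dx Hx : C12b T psi Dt Dx Hx ->
  [/\ bmeas strip (fun z => psi z.1 z.2), bmeas strip (fun z => Dt z.1 z.2),
    forall i, bmeas strip (fun z => Dx z.1 z.2 ord0 i) &
    forall i j, bmeas strip (fun z => Hx z.1 z.2 i j)].
Proof.
move=> [_ [_ [_ [[M hM] [cpsi [cDt [cDx cHx]]]]]]].
split => [||i|i j].
- by apply: (bmeas_within (M := M)) => // t x /(hM t x)[].
- by apply: (bmeas_within (M := M)) => // t x /(hM t x)[_ []].
- apply: (bmeas_within (M := M)).
    move=> z; apply: (@continuous_comp (subspace _) _ _ _ (fun v : 'rV[R]_d => v ord0 i)).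
      exact: cDx.
    exact: coord_continuous.
  by move=> t x /(hM t x)[_ [_ [h _]]]; exact: le_trans (mx_norm_coord _ _ _) h.
- apply: (bmeas_within (M := M)).
    move=> z; apply: (@continuous_comp (subspace _) _ _ _ (fun v : 'M[R]_d => v i j)).
      exact: cHx.
    exact: coord_continuous.
  by move=> t x /(hM t x)[_ [_ [_ h]]]; exact: le_trans (mx_norm_coord _ _ _) h.
Qed.

Variable mu : R -> PRd R d.
Hypothesis mmu : measurable_fun `[0, T] (mu : R -> PW R d).

Lemma bmeas_coefficient (F : R -> 'rV[R]_d -> A -> PRd R d -> R) (M : R) :
  (forall t x a m, t \in `[0, T] -> `|F t x a m| <= M) ->
  measurable_fun (`[0, T] `*` setT `*` setT `*` setT)
    (fun z : ((R * Rd R d) * Borel A) * PW R d => F z.1.1.1 z.1.1.2 z.1.2 z.2) ->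
  bmeas strip_action (fun z => F z.1.1 z.1.2 z.2 (mu z.1.1)).
Proof.
move=> hM mF.
pose P : set (((R * Rd R d) * Borel A) * PW R d) := strip_action `*` setT.
have mP : measurable P by apply: measurableX => //; exact: measurable_strip_action.
(* Inserts mu_t as the fourth argument; the clamp makes this map measurable on the whole space with
   values in [P], and it is harmless on the strip. *)
pose h (z : (R * Rd R d) * Borel A) : ((R * Rd R d) * Borel A) * PW R d :=
  (((clamp T z.1.1, z.1.2), z.2), mu (clamp T z.1.1)).
have mc : measurable_fun setT (fun z : (R * Rd R d) * Borel A => clamp T z.1.1).
  apply: measurableT_comp (measurable_clamp T) _.
  exact: measurableT_comp measurable_fst measurable_fst.
have mh : measurable_fun setT h.
  apply: measurable_fun_pair; last first.
    apply: (@measurable_comp _ _ _ _ _ _ `[0, T] (mu : R -> PW R d)) => //.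
    by move=> _ [z _ <-]; exact: clamp_itv (ltW T0) _.
  apply: measurable_fun_pair; last exact: measurable_snd.
  apply: measurable_fun_pair => //.
  exact: measurableT_comp measurable_snd measurable_fst.
have bF : bmeas P (fun z => F z.1.1.1 z.1.1.2 z.1.2 z.2).
  by split => //; exists M => -[[[t x] a] m] [[[/= tT _] _] _]; exact: hM.
have := bmeas_comp measurable_strip_action mP mh _ bF.
move=> bh; apply: bmeas_eq (bh _); last first.
  by move=> [[t x] a] _; split => //; split => //; split => //; exact: clamp_itv (ltW T0) _.
by move=> [[t x] a] [[/= tT _] _]; rewrite clampE.
Qed.

End time_space.

Lemma bmeas_Lgen (R : realType) (d : nat) (A : ptopologicalType) (T : R)
    (b : R -> 'rV[R]_d -> A -> PRd R d -> 'rV[R]_d)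
    (sig : R -> 'rV[R]_d -> A -> PRd R d -> 'M[R]_d) (mu : R -> PRd R d)
    psi Dt Dx Hx :
  (forall i, bmeas (strip_action (d := d) (A := A) T)
    (fun z => b z.1.1 z.1.2 z.2 (mu z.1.1) ord0 i)) ->
  (forall i j, bmeas (strip_action (d := d) (A := A) T)
    (fun z => sig z.1.1 z.1.2 z.2 (mu z.1.1) i j)) ->
  C12b T psi Dt Dx Hx ->
  bmeas (strip_action (d := d) (A := A) T)
    (fun z => Lgen b sig mu Dx Hx z.1.1 z.1.2 z.2).
Proof.
move=> bb bsig /C12b_bmeas[_ _ bDx bHx].
pose s i k (z : (R * Rd R d) * Borel A) := sig z.1.1 z.1.2 z.2 (mu z.1.1) i k.
pose a i (z : (R * Rd R d) * Borel A) := b z.1.1 z.1.2 z.2 (mu z.1.1) ord0 i.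
apply: (@bmeas_eq _ _ _ _ (fun z =>
    2^-1 * \sum_(i < d) \sum_(j < d) ((\sum_(k < d) s i k z * s j k z) * Hx z.1.1 z.1.2 j i)
    + \sum_(i < d) a i z * Dx z.1.1 z.1.2 ord0 i)).
  move=> z _; rewrite /Lgen; congr (_ * _ + _).
  apply: eq_bigr => i _; rewrite mxE; apply: eq_bigr => j _; rewrite mxE.
  by congr (_ * _); apply: eq_bigr => k _; rewrite mxE.
apply: bmeasD => //.
  apply: (bmeasM (f := cst 2^-1)) => //; first exact: bmeas_cst.
  apply: bmeas_sum => // i; apply: bmeas_sum => // j.
  apply: bmeasM; last exact: (bmeas_strip_action A (bHx j i)).
  by apply: bmeas_sum => // k; exact: (bmeasM (bsig i k) (bsig j k)).
apply: bmeas_sum => // i.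
exact: (bmeasM (bb i) (bmeas_strip_action A (bDx i))).
Qed.

(** * The measure carried by the graph of the feedback, and vanishing by full support *)

Section graph.
Context (R : realType) (d : nat) (A : ptopologicalType) (T : R) (mu : R -> PRd R d).
Variable (phi : R -> 'rV[R]_d -> A).
Hypotheses (T0 : 0 < T) (mmu : forall B : set (Rd R d), measurable B ->
  measurable_fun `[0, T] (fun t : R => mu t B)).
Hypothesis mphi : measurable_fun (`[0, T] `*` setT)
  (fun z : R * Rd R d => (phi z.1 z.2 : Borel A)).

Let nu := mixture T0 mmu.

(** [phi] is measurable on the strip only; the clamp extends it to all times, and the values off the
    strip are invisible to [nu]. *)
Definition graph (z : R * Rd R d) : (R * Rd R d) * Borel A :=
  (z, phi (clamp T z.1) z.2).

Lemma measurable_graph : measurable_fun setT graph.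
Proof.
apply: measurable_fun_pair; first exact: measurable_id.
apply: (@measurable_comp _ _ _ _ _ _ (strip (d := d) T)
  (fun z : R * Rd R d => (phi z.1 z.2 : Borel A)) _
  (fun z : R * Rd R d => (clamp T z.1, z.2) : R * Rd R d)).
- exact: measurable_strip.
- by move=> _ [z _ <-]; split => //; exact: clamp_itv (ltW T0) _.
- exact: mphi.
- apply: measurable_fun_pair; last exact: measurable_snd.
  exact: measurableT_comp (measurable_clamp T) measurable_fst.
Qed.

Lemma mixture_graphE E : measurable E -> nu (graph @^-1` E) =
  (\int[lebesgue_measure]_(t in `[0%R, T])
     \int[mu t]_x (\1_E ((t, x), phi t x) : R)%:E)%E.
Proof.
move=> mE.
have mB : measurable (graph @^-1` E).
  by rewrite -[X in measurable X]setTI; exact: measurable_graph.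
have -> : nu (graph @^-1` E) = (\int[nu]_z (\1_(graph @^-1` E) z : R)%:E)%E.
  by rewrite integral_indic ?setIT.
rewrite [LHS]ge0_integral_mixture//; last exact/measurable_EFinP/measurable_indic.
apply: eq_integral => t; rewrite inE => tT; apply: eq_integral => x _.
have gE : graph (t, x) = ((t, x), phi t x) by rewrite /graph /= clampE.
by rewrite !indicE -gE.
Qed.

Lemma Rintegral_graph (m : {measure set ((R * Rd R d) * Borel A)%type -> \bar R})
    (F : (R * Rd R d) * Borel A -> R) :
  (forall E, measurable E -> m E = nu (graph @^-1` E)) ->
  bmeas (strip_action (A := A) T) F ->
  \int[m]_(z in strip_action (A := A) T) F z =
    \int[lebesgue_measure]_(t in `[0, T]) \int[mu t]_x F ((t, x), phi t x).
Proof.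
move=> mE bF; have mSA := @measurable_strip_action R d A T.
transitivity (\int[image_measure nu measurable_graph]_(z in strip_action (A := A) T) F z).
  by rewrite /Rintegral; congr fine; apply: eq_measure_integral => E mE' _; exact: mE.
rewrite [LHS](Rintegral_image_measure (mixture_fin T0 mmu) measurable_graph mSA bF).
have -> : graph @^-1` (strip_action (A := A) T) = strip T.
  by apply/seteqP; split => [z [] //|z zD]; split.
have bFg : bmeas (strip (d := d) T) (fun z => F (graph z)).
  apply: (bmeas_comp (@measurable_strip R d T) mSA measurable_graph _ bF).
  by move=> z zD; split.
rewrite (Rintegral_mixture T0 mmu bFg).2.
apply: eq_Rintegral => t; rewrite inE => tT; apply: eq_Rintegral => x _.
by rewrite /graph /= clampE.
Qed.

(** If [h] is nonzero at a point of the strip, then for all times in a nondegenerate interval the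
    slice of [W] contains a fixed ball around [x0], so it has positive mu_t mass, and [nu] would
    charge [W]. *)
Lemma full_support_strip_eq0 (h : R * 'rV[R]_d -> R) :
  (forall t, t \in `]0, T] -> full_support (mu t)) ->
  {within strip (d := d) T, continuous h} ->
  nu (strip T `&` [set z | h z != 0]) = 0%E -> forall z, strip (d := d) T z -> h z = 0.
Proof.
move=> fs ch nu0 [t0 x0] zD; apply/eqP/negPn/negP => hz.
pose W : set (R * Rd R d) := strip T `&` [set z | h z != 0].
have mh : measurable_fun (strip T : set (R * Rd R d)) h.
  by apply: measurable_within_continuous => //; exact: measurable_strip.
have mW : measurable W.
  have := mh (@measurable_strip R d T) (~` [set 0]) (measurableC (measurable_set1 0)).
  by congr measurable; apply/seteqP; split => z /= [Dz /eqP].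
have b1W : bmeas (strip (d := d) T) (\1_W : R * Rd R d -> R).
  split; first exact: measurable_indic.
  by exists 1 => z _; rewrite indicE; case: (_ \in _); rewrite ?normr1 ?normr0.
have [bI eI] := Rintegral_mixture T0 mmu b1W.
have I0 : \int[lebesgue_measure]_(t in `[0, T]) \int[mu t]_x (\1_W (t, x) : R) = 0.
  rewrite -[LHS]eI /Rintegral integral_indic//; last exact: measurable_strip.
  by rewrite setIAC setIid -/W nu0.
have lebT : (lebesgue_measure (`[0%R, T]%classic : set R) < +oo)%E.
  by rewrite lebesgue_measure_itv/=; case: ifP => _; rewrite ?oppr0 ltry.
have I_ge0 t : `[0, T]%classic t -> 0 <= \int[mu t]_x (\1_W (t, x) : R).
  by move=> _; apply: Rintegral_ge0.
have mT : measurable (`[0, T]%classic : set (measurableTypeR R)) by exact: measurable_itv.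
have leb0 := Rintegral_eq0_null (m := lebesgue_measure) mT lebT bI I_ge0 I0.
have : \forall z \near (t0, x0), strip (d := d) T z -> h z != 0.
  have /subspace_continuousP/(_ _ zD) ch0 := ch.
  have : nbhs (h (t0, x0)) [set s : R | s != 0].
    by apply: open_nbhs_nbhs; split => //; exact: open_neq.
  by move=> /ch0.
move=> /nbhs_ballP[r /= r0 hr].
(* The open interval from [l] to [u] excludes time 0, where full support is not assumed, yet has
   positive length even when [t0] is an endpoint. *)
pose l := Num.max 0 (t0 - r); pose u := Num.min T (t0 + r).
have [t00 t0T] : 0 <= t0 /\ t0 <= T by case: zD => /=; rewrite in_itv/= => /andP[].
have rp : 0 < r := r0.
have lu : l < u.
  rewrite /l /u lt_min !gt_max T0/=; apply/andP; split; first lra.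
  by apply/andP; split; lra.
have sub : `]l, u[%classic `<=`
    `[0, T]%classic `&` [set t | \int[mu t]_x (\1_W (t, x) : R) != 0].
  move=> t /=; rewrite in_itv/= /l /u gt_max lt_min => /andP[/andP[tp tr] /andP[tT tr']].
  have tI : t \in `[0, T] by rewrite in_itv/= !ltW.
  split => //; rewrite gt_eqF//.
  have Wt : measurable [set x : Rd R d | W (t, x)].
    rewrite -[X in measurable X]setTI.
    exact: (pair1_measurable t measurableT mW).
  have -> : \int[mu t]_x (\1_W (t, x) : R) = fine (mu t [set x | W (t, x)]).
    rewrite /Rintegral; congr fine.
    have := @integral_indic _ _ _ (mu t) setT measurableT _ Wt.
    rewrite setIT => <-; apply: eq_integral => x _.
    by rewrite !indicE.
  apply: fine_gt0; apply/andP; split; last first.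
    apply: le_lt_trans (probability_fin (mu t)); apply: le_measure; rewrite ?inE//.
  apply: (full_support_nbhs (x := x0)) => //.
    by apply: fs; rewrite in_itv/= tp ltW.
  apply/nbhs_ballP; exists r => //= y xy; split; first by split.
  apply: hr => //; split => //=.
  by rewrite /ball/= ltr_distlC; apply/andP; split; lra.
have : (lebesgue_measure (`]l, u[%classic : set R) <= 0)%E.
  rewrite -leb0; apply: le_measure; rewrite ?inE//.
  have := bI.1 mT (~` [set 0]) (measurableC (measurable_set1 0)).
  by congr measurable; apply/seteqP; split => t /= [tI /eqP].
by rewrite lebesgue_measure_itv/= lte_fin lu -EFinD lee_fin subr_le0 leNgt lu.
Qed.

End graph.

(** * The minimal Hamiltonian and the equivalence *)

Lemma minHam_attained (R : realType) (d : nat) (A : Type)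
    (b : R -> 'rV[R]_d -> A -> PRd R d -> 'rV[R]_d)
    (sig : R -> 'rV[R]_d -> A -> PRd R d -> 'M[R]_d)
    (f : R -> 'rV[R]_d -> A -> PRd R d -> R) t x y z m a0 :
  (forall a, Ham b sig f t x y z a0 m <= Ham b sig f t x y z a m) ->
  minHam b sig f t x y z m = Ham b sig f t x y z a0 m.
Proof.
move=> h; rewrite /minHam; set S := [set _ | _ in _].
have lS : lbound S (Ham b sig f t x y z a0 m) by move=> _ [a _ <-].
apply/eqP; rewrite eq_le; apply/andP; split.
  by apply: ge_inf; [exists (Ham b sig f t x y z a0 m) | exists a0].
by apply: lb_le_inf => //; exists (Ham b sig f t x y z a0 m), a0.
Qed.

Unset Implicit Arguments.
Set Strict Implicit.

Theorem theorem6p1 (R : realType) (d : nat) (A : ptopologicalType) (T : R)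
    (b : R -> 'rV[R]_d -> A -> PRd R d -> 'rV[R]_d)
    (sig : R -> 'rV[R]_d -> A -> PRd R d -> 'M[R]_d)
    (f : R -> 'rV[R]_d -> A -> PRd R d -> R)
    (g : 'rV[R]_d -> PRd R d -> R) (rho : PRd R d)
    (mu : R -> PRd R d)
    (psis : R -> 'rV[R]_d -> R) (Dts : R -> 'rV[R]_d -> R)
    (Dxs : R -> 'rV[R]_d -> 'rV[R]_d) (Hxs : R -> 'rV[R]_d -> 'M[R]_d)
    (phi : R -> 'rV[R]_d -> A) :
  (1 <= d)%N -> 0 < T -> polish R A ->
  (* standing assumptions: b, sigma, f, g bounded and Borel measurable *)
  (exists M : R, forall t x a m, t \in `[0, T] -> `|b t x a m| <= M) ->
  (exists M : R, forall t x a m, t \in `[0, T] -> `|sig t x a m| <= M) ->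
  (exists M : R, forall t x a m, t \in `[0, T] -> `|f t x a m| <= M) ->
  (exists M : R, forall x m, `|g x m| <= M) ->
  (forall i : 'I_d, measurable_fun (`[0, T] `*` setT `*` setT `*` setT)
     (fun z : ((R * Rd R d) * Borel A) * PW R d =>
        b z.1.1.1 z.1.1.2 z.1.2 z.2 ord0 i)) ->
  (forall i j : 'I_d, measurable_fun (`[0, T] `*` setT `*` setT `*` setT)
     (fun z : ((R * Rd R d) * Borel A) * PW R d =>
        sig z.1.1.1 z.1.1.2 z.1.2 z.2 i j)) ->
  measurable_fun (`[0, T] `*` setT `*` setT `*` setT)
     (fun z : ((R * Rd R d) * Borel A) * PW R d => f z.1.1.1 z.1.1.2 z.1.2 z.2) ->
  measurable_fun setT (fun z : Rd R d * PW R d => g z.1 z.2) ->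
  (* mu is a probability kernel on [0,T], narrowly continuous *)
  (forall B : set (Rd R d), measurable B ->
     measurable_fun `[0, T] (fun t : R => mu t B)) ->
  (forall h : 'rV[R]_d -> R, bcont h ->
     {within `[0, T], continuous (fun t => Rintegral (mu t) setT h)}) ->
  (* psi^* in C^{1,2}_b *)
  C12b T psis Dts Dxs Hxs ->
  (* phi measurable, phi(t,x) the unique minimizer of the Hamiltonian *)
  measurable_fun (`[0, T] `*` setT) (fun z : R * Rd R d => (phi z.1 z.2 : Borel A)) ->
  (forall t x, t \in `[0, T] ->
     (forall a, Ham b sig f t x (Dxs t x) (Hxs t x) (phi t x) (mu t)
                <= Ham b sig f t x (Dxs t x) (Hxs t x) a (mu t)) /\
     (forall a, (forall a', Ham b sig f t x (Dxs t x) (Hxs t x) a (mu t)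
                            <= Ham b sig f t x (Dxs t x) (Hxs t x) a' (mu t)) ->
                a = phi t x)) ->
  (* continuity assumptions *)
  continuous (fun x => g x (mu T)) ->
  {within `[0, T] `*` [set: 'rV[R]_d],
     continuous (fun z : R * 'rV[R]_d =>
       minHam b sig f z.1 z.2 (Dxs z.1 z.2) (Hxs z.1 z.2) (mu z.1))} ->
  (* full support of mu_t for t in (0,T] *)
  (forall t, t \in `]0, T] -> forall (x : 'rV[R]_d) (r : R), 0 < r ->
     (0 < mu t [set y : Rd R d | (eucl (y - x) < r)%R])%E) ->
  forall xi : {finite_measure set ((R * Rd R d) * Borel A)%type -> \bar R},
  xi (~` (`[0, T] `*` setT `*` setT)) = 0%E ->
  PD T b sig f g rho mu xi psis Dts Dxs Hxs <->
  ((forall E : set ((R * Rd R d) * Borel A), measurable E ->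
      xi E = (\int[lebesgue_measure]_(t in `[0%R, T])
                \int[mu t]_x (\1_E ((t, x), phi t x) : R)%:E)%E) /\
   (* (a) *)
   (forall psi Dt Dx Hx, C12b T psi Dt Dx Hx ->
      Rintegral (mu T) setT (fun x => psi T x) - Rintegral rho setT (fun x => psi 0 x)
      = Rintegral lebesgue_measure `[0, T]
          (fun t => Rintegral (mu t) setT
             (fun x => Lgen b sig mu Dx Hx t x (phi t x) + Dt t x))) /\
   (* (b) *)
   (forall t x, t \in `[0, T] ->
      Dts t x + minHam b sig f t x (Dxs t x) (Hxs t x) (mu t) = 0) /\
   (forall x, psis T x = g x (mu T))).
Proof.
move=> _ T0 _ [Mb hMb] [Ms hMs] [Mf hMf] [Mg hMg] mb ms mf mg mmu cmu Cpsi mphi hphi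
  cg cH fs xi xi0.
have mmuW : measurable_fun `[0, T] (mu : R -> PW R d).
  by apply: measurable_narrow => //; exact: measurable_itv.
pose SA : set ((R * Rd R d) * Borel A) := strip_action (A := A) T.
have mSA : measurable SA by exact: (@measurable_strip_action R d A T).
have mS : measurable (strip (d := d) T) by exact: (@measurable_strip R d T).
have xifin E : measurable E -> (xi E < +oo)%E.
  by move=> mE; rewrite -ge0_fin_numE//; exact: fin_num_measure.
have xiR (F : (R * Rd R d) * Borel A -> R) : \int[xi]_z F z = \int[xi]_(z in SA) F z.
  exact: Rintegral_conull.
have bb i : bmeas SA (fun z => b z.1.1 z.1.2 z.2 (mu z.1.1) ord0 i).
  apply: (bmeas_coefficient T0 mmuW (F := fun t x a m => b t x a m ord0 i) (M := Mb)) => //.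
  by move=> t x a m tT; apply: le_trans (hMb t x a m tT); exact: mx_norm_coord.
have bs i j : bmeas SA (fun z => sig z.1.1 z.1.2 z.2 (mu z.1.1) i j).
  apply: (bmeas_coefficient T0 mmuW (F := fun t x a m => sig t x a m i j) (M := Ms)) => //.
  by move=> t x a m tT; apply: le_trans (hMs t x a m tT); exact: mx_norm_coord.
have bf : bmeas SA (fun z => f z.1.1 z.1.2 z.2 (mu z.1.1)).
  exact: (bmeas_coefficient T0 mmuW (F := f) (M := Mf)).
have bL psi Dt Dx Hx : C12b T psi Dt Dx Hx ->
    bmeas SA (fun z => Lgen b sig mu Dx Hx z.1.1 z.1.2 z.2 + Dt z.1.1 z.1.2).
  move=> C; have [_ bDt _ _] := C12b_bmeas C.
  exact: bmeasD (bmeas_Lgen bb bs C) (bmeas_strip_action A bDt).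
have bpsiA psi Dt Dx Hx : C12b T psi Dt Dx Hx -> bmeas SA (fun z => psi z.1.1 z.1.2).
  by move=> C; have [bp _ _ _] := C12b_bmeas C; exact: (bmeas_strip_action A bp).
(* The slack in (iv), grouped so that its integral splits into the right side of (ii) at [psis] and
   the running cost in (i). *)
pose G (z : (R * Rd R d) * Borel A) := Lgen b sig mu Dxs Hxs z.1.1 z.1.2 z.2 + Dts z.1.1 z.1.2
  + f z.1.1 z.1.2 z.2 (mu z.1.1).
have bG : bmeas SA G by exact: bmeasD (bL _ _ _ _ Cpsi) bf.
have GHam t x a : G ((t, x), a) =
    Dts t x + Ham b sig f t x (Dxs t x) (Hxs t x) a (mu t).
  by rewrite /G /Ham /Lgen /=; ring.
(* The residual of the Hamilton-Jacobi-Bellman equation, which on the strip is the minimum of [G]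
   over actions, attained at [phi]. *)
pose h (z : R * 'rV[R]_d) :=
  Dts z.1 z.2 + minHam b sig f z.1 z.2 (Dxs z.1 z.2) (Hxs z.1 z.2) (mu z.1).
have minE t x : t \in `[0, T] -> minHam b sig f t x (Dxs t x) (Hxs t x) (mu t) =
    Ham b sig f t x (Dxs t x) (Hxs t x) (phi t x) (mu t).
  by move=> /(hphi t x)[hmin _]; exact: minHam_attained.
have hG t x : t \in `[0, T] -> h (t, x) = G ((t, x), phi t x).
  by move=> tT; rewrite GHam /h /= minE.
have hleG t x a : t \in `[0, T] -> h (t, x) <= G ((t, x), a).
  by move=> tT; rewrite hG// !GHam lerD2l; have [+ _] := hphi t x tT; exact.
have T_in : T \in `[0, T] by rewrite in_itv/= lexx ltW.
have TI : `[0, T]%classic T by [].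
have cpsiT : continuous (fun x => psis T x).
  have [_ [_ [_ [_ [cp _]]]]] := Cpsi.
  exact: (within_slice_continuous TI cp).
have bgT : bmeas setT (fun x : Rd R d => g x (mu T)).
  split; last by exists Mg => x _; exact: hMg.
  exact: (measurable_fun_pair1 (mu T : PW R d) mg).
have bpT : bmeas setT (fun x : Rd R d => psis T x).
  have [bp _ _ _] := C12b_bmeas Cpsi.
  exact: (mixture_section bp T_in).
have ch : {within strip (d := d) T, continuous h}.
  have [_ [_ [_ [_ [_ [cDt _]]]]]] := Cpsi.
  by move=> z; apply: cvgD; [exact: cDt | exact: cH].
have fsT : full_support (mu T).
  by move=> x r r0; apply: fs => //; rewrite in_itv/= T0 lexx.
have prfin (m : PRd R d) : (m setT < +oo)%E by exact: probability_fin.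
pose nu := mixture T0 mmu.
pose gr := graph (A := A) T phi.
have mgr : measurable_fun setT gr by exact: measurable_graph.
have mpre E : measurable E -> measurable (gr @^-1` E).
  by move=> mE; rewrite -[X in measurable X]setTI; exact: mgr.
have xigraph : (forall E : set ((R * Rd R d) * Borel A), measurable E ->
      xi E = (\int[lebesgue_measure]_(t in `[0%R, T])
                \int[mu t]_x (\1_E ((t, x), phi t x) : R)%:E)%E) <->
    (forall E, measurable E -> xi E = nu (gr @^-1` E)).
  by split => H E mE; rewrite H//; [symmetry|]; exact: mixture_graphE.
have xiF (F : (R * Rd R d) * Borel A -> R) :
    (forall E, measurable E -> xi E = nu (gr @^-1` E)) -> bmeas SA F ->
    \int[xi]_z F z = \int[lebesgue_measure]_(t in `[0, T]) \int[mu t]_x F ((t, x), phi t x).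
  by move=> hxi bF; rewrite xiR; exact: (Rintegral_graph mphi hxi bF).
rewrite xigraph; split.
  move=> [pd1 [pd2 [pd3 [pd4 pd5]]]].
  have e2 := pd2 _ _ _ _ Cpsi.
  have G_ge0 z : SA z -> 0 <= G z.
    move: z => [[t x] a] [[/= tT _] _]; have := pd4 t x a tT.
    by rewrite /G /= [Lgen _ _ _ _ _ _ _ _ + _]addrC.
  have d_ge0 x : setT x -> 0 <= g x (mu T) - psis T x by move=> _; rewrite subr_ge0.
  have eG : \int[xi]_(z in SA) G z =
      \int[xi]_z (Lgen b sig mu Dxs Hxs z.1.1 z.1.2 z.2 + Dts z.1.1 z.1.2) +
      \int[xi]_z f z.1.1 z.1.2 z.2 (mu z.1.1).
    by rewrite !xiR (bmeas_RintegralD (m := xi) mSA (xifin _ mSA) (bL _ _ _ _ Cpsi) bf).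
  have ed : \int[mu T]_x (g x (mu T) - psis T x) =
      \int[mu T]_x g x (mu T) - \int[mu T]_x psis T x.
    exact: (bmeas_RintegralB (m := mu T) measurableT (prfin (mu T)) bgT bpT).
  have p1 := Rintegral_ge0 (mu T) d_ge0.
  have p2 := Rintegral_ge0 xi G_ge0.
  (* Combining (i) with (ii) at [psis] cancels the initial term and gives total 0 for the two slack
     integrals; both are nonnegative, so each is 0. *)
  have i1 : \int[mu T]_x (g x (mu T) - psis T x) = 0 by lra.
  have i2 : \int[xi]_(z in SA) G z = 0 by lra.
  have n1 := Rintegral_eq0_null (m := mu T) measurableT (prfin (mu T)) (bmeasB bgT bpT) d_ge0 i1.
  have n2 := Rintegral_eq0_null (m := xi) mSA (xifin _ mSA) bG G_ge0 i2.
  have mN : measurable (SA `&` [set z | G z != 0]).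
    have := bG.1 mSA (~` [set 0]) (measurableC (measurable_set1 0)).
    by congr measurable; apply/seteqP; split => z /= [Dz /eqP].
  (* The terminal slack is continuous and vanishes almost everywhere for a measure of full
     support. *)
  have hb2 x : psis T x = g x (mu T).
    apply/esym/eqP; rewrite -subr_eq0; apply/eqP; move: x.
    apply: (full_support_eq0 fsT); last by rewrite setTI in n1.
    by move=> x; exact: (continuousB (cg x) (cpsiT x)).
  have marg E : measurable E -> xi (fst @^-1` E) = nu E.
    move=> mE.
    apply: (@finite_measure_eq_C12b R d T (image_measure xi measurable_fst) nu _ _ _ E mE).
    - exact: (xifin _ measurableT).
    - exact: mixture_fin.
    move=> psi Dt Dx Hx C; have [bp _ _ _] := C12b_bmeas C.
    rewrite (@Rintegral_conull _ _ _ (image_measure xi measurable_fst) (strip T)) //; last first.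
      rewrite image_measureE -[RHS]xi0; congr (xi _).
      by apply/seteqP; split => z /= hz hn; apply: hz; [case: hn|split].
    rewrite [RHS](@Rintegral_conull _ _ _ nu (strip T)) //; last exact: mixtureC.
    rewrite (Rintegral_image_measure (xifin _ measurableT) measurable_fst mS bp).
    rewrite (_ : fst @^-1` strip T = SA); last first.
      by apply/seteqP; split => [z zS|z []//]; split.
    rewrite -xiR -(pd5 _ _ _ _ C) [RHS](Rintegral_mixture T0 mmu bp).2.
    by [].
  have h0 z : strip (d := d) T z -> h z = 0.
    apply: (full_support_strip_eq0 fs ch).
    have mW : measurable (strip T `&` [set z : R * Rd R d | h z != 0]).
      have := measurable_within_continuous mS ch mS (measurableC (measurable_set1 0)).
      by congr measurable; apply/seteqP; split => y /= [Dy /eqP].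
    (* The [nu]-mass becomes the [xi]-mass of the cylinder over the points with [h] nonzero. There
       [G] is nonzero for every action, since [h] lies between 0 and [G]; so the cylinder sits in
       the null set of [n2]. *)
    rewrite -[LHS](marg _ mW); apply/eqP; rewrite eq_le measure_ge0 andbT -n2.
    apply: le_measure; rewrite ?inE//.
      by rewrite -[X in measurable X]setTI; exact: measurable_fst.
    move=> [[t x] a] [[/= tT _] hn]; split; first by split.
    apply: contra_neq hn => G0; apply/eqP; rewrite eq_le -{1}G0 hleG//=.
    by rewrite hG//; apply: G_ge0; split.
  (* With [h = 0], a zero of [G] has the same Hamiltonian value as [phi], so its action is a
     minimizer and uniqueness applies. *)
  have Gphi z : SA z -> G z = 0 -> z = gr z.1.
    move: z => [[t x] a] [[/= tT _] _] G0; rewrite /gr /graph /= clampE//; congr (_, _).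
    have [_ huniq] := hphi t x tT; apply: huniq => a'.
    have [hmin _] := hphi t x tT; apply: le_trans (hmin a').
    have := G0; rewrite GHam -(h0 (t, x) (conj tT I)) hG// GHam => /addrI ->.
    exact: lexx.
  have hxi E : measurable E -> xi E = nu (gr @^-1` E).
    move=> mE; rewrite -[RHS]marg; last exact: mpre.
    pose N := ~` SA `|` (SA `&` [set z | G z != 0]).
    have mN' : measurable N by apply: measurableU => //; exact: measurableC.
    have N0 : xi N = 0.
      apply/eqP; rewrite eq_le measure_ge0 andbT.
      apply: (le_trans (measureU2 _ _ _)) => //; first exact: measurableC.
      by rewrite [X in (X + _)%E]xi0 [X in (_ + X)%E]n2 adde0.
    have xiD B : measurable B -> xi B = xi (B `\` N).
      move=> mB; rewrite measureD//; last exact: xifin.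
      rewrite [X in (_ - X)%E](_ : _ = 0%E); first by rewrite sube0.
      apply/eqP; rewrite eq_le measure_ge0 andbT -N0.
      by apply: le_measure; rewrite ?inE//; exact: measurableI.
    rewrite (xiD _ mE) [RHS]xiD; last first.
      by rewrite -[X in measurable X]setTI; apply: measurable_fst => //; exact: mpre.
    have notN z : ~ N z -> z = gr z.1.
      move=> zN; have zSA : SA z by apply: contrapT => h'; apply: zN; left.
      apply: Gphi => //; apply/eqP/negPn/negP => Gz; apply: zN; right.
      by split.
    congr (xi _); apply/seteqP; split => z [zE zN]; split => //.
      by rewrite /= -notN.
    by rewrite (notN _ zN).
  split; first exact: hxi.
  split.
    by move=> psi Dt Dx Hx C; rewrite (pd2 _ _ _ _ C) (xiF _ hxi (bL _ _ _ _ C)).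
  by split => [t x tT|//]; exact: (h0 (t, x) (conj tT I)).
move=> [hxi [ha [hb1 hb2]]].
have G0 t x : t \in `[0, T] -> G ((t, x), phi t x) = 0 by move=> tT; rewrite -hG//; exact: hb1.
split.
  (* For (i): by (b) the integral of [G] along the graph is 0; splitting it and evaluating the
     generator part with (a) at [psis] leaves (i) once [psis T] is replaced by [g]. *)
  have e1 := ha _ _ _ _ Cpsi.
  have := xiF _ hxi (bL _ _ _ _ Cpsi); rewrite -e1 => e2.
  have := xiF _ hxi bG.
  rewrite [RHS](_ : _ = 0); last first.
    apply: Rintegral_eq0 => t tT; apply: Rintegral_eq0 => x _; exact: G0.
  rewrite xiR bmeas_RintegralD//; last 2 first.
  - exact: xifin.
  - exact: bL Cpsi.
  rewrite -!xiR e2 (_ : Rintegral (mu T) setT (fun x => g x (mu T)) =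
    Rintegral (mu T) setT (fun x => psis T x)); last first.
    by apply: eq_Rintegral => x _; rewrite hb2.
  by move=> e3; lra.
split; first by move=> psi Dt Dx Hx C; rewrite (ha _ _ _ _ C) (xiF _ hxi (bL _ _ _ _ C)).
split; first by move=> x; rewrite hb2.
split; last by move=> psi Dt Dx Hx C; rewrite (xiF _ hxi (bpsiA _ _ _ _ C)).
(* Since (b) makes the residual [h] zero, the inequality of [h] with [G] is exactly (iv). *)
move=> t x a tT; have := hleG t x a tT; rewrite /h /= hb1// /G /=.
by rewrite [_ + Dts t x]addrC.
Qed.
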